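(* Let $b>0$ and $z_l>0$ be fixed real numbers, and let $a_k^*<a_{k-1}^*$ be two consecutive real zeros of the function $a\mapsto\Phi(a,b,z_l)$ (i.e. $\Phi(a_k^*,b,z_l)=\Phi(a_{k-1}^*,b,z_l)=0$ and $\Phi(a,b,z_l)\neq 0$ for $a_k^*<a<a_{k-1}^*$). For $j\in\{k-1,k\}$ put $$g_j=\exp\!\left(\frac{2\pi}{\sqrt{(b-2a_j^* )^2-(b-1)^2}}\right),\qquad \beta_j=b-a_j^*-1 .$$ If $z_l<\beta_{k-1}/g_{k-1}$ (where this hypothesis includes that $(b-2a_{k-1}^* )^2-(b-1)^2>0$, so that $g_{k-1}$ is a well-defined positive real number), then $\Delta a=a_{k-1}^*-a_k^*$ satisfies $$\Delta a\;\ge\;\beta_k-\frac{\beta_k}{4g_k}\left[2+\sqrt{z_l/\beta_k}\,(g_k-1)\right]^2 .$$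
   Context: The confluent hypergeometric function of the first kind is $\Phi(a,b,z)=\sum_{n=0}^{\infty}\frac{(a)_n}{(b)_n\,n!}z^n$, where $(a)_0=1$ and $(a)_n=a(a+1)\cdots(a+n-1)$. For fixed $b,z>0$ it is an entire function of $a$ whose zeros are all real, simple and negative, and form an infinite sequence tending to $-\infty$; they are labeled in decreasing order $0>a_1^*>a_2^*>\cdots$. *)

(* Defs.v *)
From Stdlib Require Export Reals Factorial.
From Coquelicot Require Export Coquelicot.
Open Scope R_scope.

Fixpoint pochhammer (a : R) (n : nat) : R :=
  match n with
  | O => 1
  | S m => pochhammer a m * (a + INR m)
  end.

(* [PSeries] is total; the series converges for every z when b is not a nonpositive integer. *)
Definition Phi (a b z : R) : R :=
  PSeries (fun n => pochhammer a n / (pochhammer b n * INR (Factorial.fact n))) z.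

Definition discr (b a : R) : R := (b - 2 * a) ^ 2 - (b - 1) ^ 2.

(* [g b a] carries its intended meaning only when [discr b a] is positive,
   since [sqrt] is 0 on negative arguments. *)
Definition g (b a : R) : R := exp (2 * PI / sqrt (discr b a)).

Definition beta (b a : R) : R := b - a - 1.

(* Main.v *)
Require Import Defs.
From Stdlib Require Import Reals Factorial Lra Psatz Classical.
From Coquelicot Require Import Coquelicot.
Open Scope R_scope.

(** In the variable [ln z], the Liouville normal form of Kummer's equation is [u'' + Om u = 0]
    with [Om = - (z^2 - 2 (b - 2a) z + (b-1)^2) / 4 <= discr b a / 4], so by Sturm's comparison
    theorem the ratio of consecutive zeros of [Phi a b] is at least [g b a].  Comparing
    [Phi a b] with the rescaled [Phi a' b (l z)] shows that, along a curve of zeros [(a, z)],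
    the quantity [z (b - 2a) - z^2 / 2] does not increase with [a].  Following the zero [zl] of
    [Phi ak1 b] down to the zero [y <= zl / g b ak] of [Phi ak b] that precedes [zl] yields
    [b - 2 ak1 - zl / 2 <= (b - 2 ak) / g - zl / (2 g^2)] with [g = g b ak].  The stated bound
    is weaker, because a zero lies beyond the turning point [Om = 0], which gives
    [b - 2 + zl <= 2 sqrt (zl * beta b ak)]. *)

(** * Kummer's series and differential equation *)

(** Passing to ln z turns the rescaling of z to l z into a translation, so the term (b-1)^2 cancels
    when two normal forms are compared, and the difference [qdiff], taken after division by z, is
    linear in z. If (a, m) and (a', u) lie on one level of z (b - 2a) - z^2 / 2 and l = u / m, this
    linear function vanishes exactly at z = m, hence keeps one sign on (0, m). This is what singles
    out that quantity. The usual way to follow a zero is to differentiate it in a by the implicit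
    function theorem. Here Phi is only shown to be Lipschitz in a, and no derivative in a is taken:
    finite comparisons of nearby parameters replace it, with a radius that does not depend on how
    small the difference of the coefficients is. The comparisons start at the singular endpoint 0,
    where the Wronskian tends to 0 because b > 0, so no boundary term appears there. *)

Definition kummer_coef (a b : R) (n : nat) : R :=
  pochhammer a n / (pochhammer b n * INR (fact n)).

(** The z-derivatives are kept as Kummer functions with shifted parameters, so that bounds proved
    for [Phi] apply to them as well. *)
Definition dPhi (a b z : R) : R := a / b * Phi (a + 1) (b + 1) z.

Definition d2Phi (a b z : R) : R := a / b * dPhi (a + 1) (b + 1) z.

Lemma pochhammer_pos (a : R) (n : nat) : 0 < a -> 0 < pochhammer a n.
Proof.
  intros ha; induction n as [|n IH]; simpl; [lra|].
  apply Rmult_lt_0_compat; [exact IH|].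
  pose proof (pos_INR n); lra.
Qed.

Lemma pochhammer_shift (a : R) (n : nat) :
  pochhammer a (S n) = a * pochhammer (a + 1) n.
Proof.
  induction n as [|n IH]; [simpl; ring|].
  change (pochhammer a (S (S n))) with (pochhammer a (S n) * (a + INR (S n))).
  rewrite IH, S_INR; simpl; ring.
Qed.

Lemma pochhammer_abs_le (a A : R) (n : nat) :
  Rabs a <= A -> Rabs (pochhammer a n) <= pochhammer A n.
Proof.
  intros h; induction n as [|n IH]; simpl; [rewrite Rabs_R1; lra|].
  rewrite Rabs_mult; apply Rmult_le_compat; try apply Rabs_pos; [exact IH|].
  apply Rle_trans with (1 := Rabs_triang _ _).
  rewrite (Rabs_pos_eq (INR n)) by apply pos_INR; lra.
Qed.

(** In the product rule the two terms contribute A + n and 1, which add up to A + 1 + n, the next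
    factor of the Pochhammer symbol of A + 1. *)
Lemma pochhammer_lipschitz (a a' A : R) (n : nat) :
  Rabs a <= A -> Rabs a' <= A ->
  Rabs (pochhammer a n - pochhammer a' n) <= Rabs (a - a') * pochhammer (A + 1) n.
Proof.
  intros h h'; induction n as [|n IH]; simpl.
  { rewrite Rminus_diag, Rabs_R0; pose proof (Rabs_pos (a - a')); lra. }
  replace (pochhammer a n * (a + INR n) - pochhammer a' n * (a' + INR n)) with
    ((pochhammer a n - pochhammer a' n) * (a + INR n) + pochhammer a' n * (a - a')) by ring.
  apply Rle_trans with (1 := Rabs_triang _ _); rewrite !Rabs_mult.
  assert (h1 : Rabs (a + INR n) <= A + INR n).
  { apply Rle_trans with (1 := Rabs_triang _ _).
    rewrite (Rabs_pos_eq (INR n)) by apply pos_INR; lra. }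
  assert (h2 : Rabs (pochhammer a' n) <= pochhammer (A + 1) n).
  { apply pochhammer_abs_le; lra. }
  pose proof (Rmult_le_compat _ _ _ _ (Rabs_pos _) (Rabs_pos _) IH h1).
  pose proof (Rmult_le_compat_r _ _ _ (Rabs_pos (a - a')) h2).
  nra.
Qed.

Lemma kummer_coef_den_pos (b : R) (n : nat) :
  0 < b -> 0 < pochhammer b n * INR (fact n).
Proof.
  intros hb; apply Rmult_lt_0_compat; [now apply pochhammer_pos | apply INR_fact_lt_0].
Qed.

Lemma kummer_coef_succ (a b : R) (n : nat) : 0 < b ->
  (b + INR n) * INR (S n) * kummer_coef a b (S n) = (a + INR n) * kummer_coef a b n.
Proof.
  intros hb; unfold kummer_coef.
  pose proof (pochhammer_pos b n hb); pose proof (INR_fact_lt_0 n); pose proof (pos_INR n).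
  rewrite fact_simpl, mult_INR; cbn [pochhammer]; rewrite S_INR; field; lra.
Qed.

Lemma kummer_coef_radius_pos (a b : R) : 0 < a -> 0 < b ->
  CV_radius (kummer_coef a b) = p_infty.
Proof.
  intros ha hb.
  assert (hpos : forall n, 0 < kummer_coef a b n).
  { intros n; apply Rdiv_lt_0_compat; [now apply pochhammer_pos | now apply kummer_coef_den_pos]. }
  apply CV_radius_infinite_DAlembert.
  { intros n; apply Rgt_not_eq, hpos. }
  apply is_lim_seq_le_le with (u := fun _ => 0) (w := fun n => (a / b + 1) * / INR (S n)).
  - intros n; split; [apply Rabs_pos|].
    pose proof (pos_INR n); pose proof (hpos n).
    assert (0 < INR (S n)) by (rewrite S_INR; lra).
    assert (e : kummer_coef a b (S n) / kummer_coef a b n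
                = (a + INR n) / ((b + INR n) * INR (S n))).
    { pose proof (kummer_coef_succ a b n hb) as e.
      apply Rmult_eq_reg_r with ((b + INR n) * INR (S n) * kummer_coef a b n);
        [|apply Rgt_not_eq; apply Rmult_lt_0_compat; [apply Rmult_lt_0_compat; lra | lra]].
      transitivity ((b + INR n) * INR (S n) * kummer_coef a b (S n)); [field; lra|].
      rewrite e; field; lra. }
    rewrite e, Rabs_pos_eq by (apply Rdiv_le_0_compat; nra).
    replace ((a + INR n) / ((b + INR n) * INR (S n)))
      with ((a + INR n) / (b + INR n) * / INR (S n)) by (field; lra).
    apply Rmult_le_compat_r; [left; now apply Rinv_0_lt_compat|].
    apply Rle_div_l; [lra|].
    replace ((a / b + 1) * (b + INR n)) with (a + INR n + (a / b * INR n + b)) by (field; lra).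
    pose proof (Rdiv_lt_0_compat a b ha hb); nra.
  - apply is_lim_seq_const.
  - replace (Finite 0) with (Rbar_mult (a / b + 1) 0) by (simpl; f_equal; ring).
    apply is_lim_seq_scal_l.
    apply (is_lim_seq_incr_1 (fun n => / INR n)).
    replace (Finite 0) with (Rbar_inv p_infty) by reflexivity.
    apply is_lim_seq_inv; [apply is_lim_seq_INR | discriminate].
Qed.

Lemma kummer_coef_abs_le (a A b : R) (n : nat) : Rabs a <= A -> 0 < b ->
  Rabs (kummer_coef a b n) <= kummer_coef A b n.
Proof.
  intros h hb; unfold kummer_coef; rewrite Rabs_div
    by (apply Rgt_not_eq; now apply kummer_coef_den_pos).
  rewrite (Rabs_pos_eq (_ * _)) by (left; now apply kummer_coef_den_pos).
  apply Rmult_le_compat_r; [left; apply Rinv_0_lt_compat; now apply kummer_coef_den_pos|].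
  now apply pochhammer_abs_le.
Qed.

(** When a is a nonpositive integer the coefficients are eventually 0 and the ratio test does not
    apply; the series is instead dominated by the one with the positive parameter |a| + 1. *)
Lemma kummer_coef_radius (a b : R) : 0 < b -> CV_radius (kummer_coef a b) = p_infty.
Proof.
  intros hb.
  pose proof (Rabs_pos a).
  assert (h : Rbar_le (CV_radius (kummer_coef (Rabs a + 1) b)) (CV_radius (kummer_coef a b))).
  { refine (is_lub_Rbar_subset _ _ _ _ _ (CV_radius_bounded _) (CV_radius_bounded _)).
    intros r [M hM]; exists M; intros n; apply Rle_trans with (2 := hM n).
    rewrite !Rabs_mult; apply Rmult_le_compat_r; [apply Rabs_pos|].
    apply Rle_trans with (2 := Rle_abs _).
    apply kummer_coef_abs_le; lra. }
  rewrite kummer_coef_radius_pos in h by lra.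
  destruct (CV_radius (kummer_coef a b)); simpl in h; easy.
Qed.

Lemma kummer_ex_series (a b z : R) : 0 < b ->
  ex_series (fun n => Rabs (kummer_coef a b n * z ^ n)).
Proof.
  intros hb; apply CV_disk_inside; now rewrite kummer_coef_radius.
Qed.

Lemma Phi_at_0 (a b : R) : Phi a b 0 = 1.
Proof. unfold Phi; rewrite PSeries_0; simpl; field. Qed.

Lemma PS_derive_kummer_coef (a b : R) (n : nat) : 0 < b ->
  PS_derive (kummer_coef a b) n = a / b * kummer_coef (a + 1) (b + 1) n.
Proof.
  intros hb; unfold PS_derive, kummer_coef.
  rewrite !pochhammer_shift, fact_simpl, mult_INR.
  assert (0 < pochhammer (b + 1) n) by (apply pochhammer_pos; lra).
  pose proof (INR_fact_lt_0 n).
  pose proof (pos_INR n); rewrite S_INR; field; lra.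
Qed.

Lemma is_derive_Phi (a b z : R) : 0 < b -> is_derive (Phi a b) z (dPhi a b z).
Proof.
  intros hb.
  replace (dPhi a b z) with (PSeries (PS_derive (kummer_coef a b)) z).
  - apply (is_derive_PSeries (kummer_coef a b)); now rewrite kummer_coef_radius.
  - rewrite (PSeries_ext _ (PS_scal (a / b) (kummer_coef (a + 1) (b + 1)))).
    + now rewrite PSeries_scal.
    + intros n; now apply PS_derive_kummer_coef.
Qed.

Lemma is_derive_dPhi (a b z : R) : 0 < b -> is_derive (dPhi a b) z (d2Phi a b z).
Proof.
  intros hb; apply (is_derive_scal (Phi (a + 1) (b + 1))).
  apply is_derive_Phi; lra.
Qed.

(** Both sides are power series in z; comparing coefficients leaves exactly the recursion
    [kummer_coef_succ]. *)
Lemma kummer_ode (a b z : R) : 0 < b ->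
  z * d2Phi a b z + (b - z) * dPhi a b z = a * Phi a b z.
Proof.
  intros hb.
  set (c := kummer_coef a b).
  assert (e1 : forall x, dPhi a b x = PSeries (PS_derive c) x).
  { intros x; symmetry; rewrite <- (is_derive_unique _ _ _ (is_derive_Phi a b x hb)).
    symmetry; apply (Derive_PSeries c); unfold c; now rewrite kummer_coef_radius. }
  assert (r1 : CV_radius (PS_derive c) = p_infty).
  { rewrite CV_radius_derive; now apply kummer_coef_radius. }
  assert (e2 : d2Phi a b z = PSeries (PS_derive (PS_derive c)) z).
  { rewrite <- (is_derive_unique _ _ _ (is_derive_dPhi a b z hb)).
    rewrite (Derive_ext _ _ z e1).
    apply Derive_PSeries; now rewrite r1. }
  assert (r2 : CV_radius (PS_derive (PS_derive c)) = p_infty).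
  { now rewrite CV_radius_derive. }
  assert (ex : forall d : nat -> R, CV_radius d = p_infty -> ex_pseries d z).
  { intros d hd; apply CV_radius_inside; now rewrite hd. }
  rewrite e2, e1; change (Phi a b z) with (PSeries c z).
  rewrite Rmult_minus_distr_r.
  rewrite <- !PSeries_incr_1, <- !PSeries_scal.
  rewrite <- PSeries_minus.
  2: { apply ex_pseries_scal; [apply Rmult_comm | now apply ex]. }
  2: { apply ex_pseries_incr_1; now apply ex. }
  rewrite <- PSeries_plus.
  2: { apply ex_pseries_incr_1; now apply ex. }
  2: { apply ex_pseries_minus; [apply ex_pseries_scal; [apply Rmult_comm | now apply ex]|].
       apply ex_pseries_incr_1; now apply ex. }
  apply PSeries_ext; intros n.
  pose proof (kummer_coef_succ a b n hb) as e; fold c in e.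
  unfold PS_minus, PS_plus, PS_opp, PS_scal, PS_incr_1, PS_derive, plus, opp, scal, mult, zero.
  cbn -[INR] in e |- *.
  (* Multiplication by z puts 0 in degree 0, so the constant term is a separate case. *)
  destruct n as [|n]; rewrite ?S_INR in *; cbn -[INR] in *; rewrite ?INR_0 in *; [lra|].
  lra.
Qed.

(** * Lipschitz bounds and simplicity of the zeros *)

Lemma Phi_lipschitz_param (a a' A b z : R) :
  0 < b -> Rabs a <= A -> Rabs a' <= A -> 0 <= z ->
  Rabs (Phi a b z - Phi a' b z) <= Rabs (a - a') * Phi (A + 1) b z.
Proof.
  intros hb h h' hz.
  assert (ex : forall c, ex_pseries (kummer_coef c b) z).
  { intros c; apply CV_radius_inside; now rewrite kummer_coef_radius. }
  change (Rabs (PSeries (kummer_coef a b) z - PSeries (kummer_coef a' b) z)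
          <= Rabs (a - a') * PSeries (kummer_coef (A + 1) b) z).
  rewrite <- PSeries_minus, <- PSeries_scal by apply ex.
  assert (hle : forall n, 0 <= Rabs (PS_minus (kummer_coef a b) (kummer_coef a' b) n * z ^ n)
     <= PS_scal (Rabs (a - a')) (kummer_coef (A + 1) b) n * z ^ n).
  { intros n; split; [apply Rabs_pos|].
    rewrite Rabs_mult, (Rabs_pos_eq (z ^ n)) by now apply pow_le.
    apply Rmult_le_compat_r; [now apply pow_le|].
    unfold PS_minus, PS_plus, PS_opp, PS_scal, plus, opp, scal, kummer_coef; cbn -[fact INR].
    unfold mult; cbn -[fact INR].
    pose proof (kummer_coef_den_pos b n hb) as hd.
    replace (pochhammer a n / (pochhammer b n * INR (fact n))
             + - (pochhammer a' n / (pochhammer b n * INR (fact n))))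
      with ((pochhammer a n - pochhammer a' n) * / (pochhammer b n * INR (fact n)))
      by (field; split; apply Rgt_not_eq; [apply INR_fact_lt_0 | now apply pochhammer_pos]).
    unfold Rdiv; rewrite <- Rmult_assoc, Rabs_mult.
    rewrite (Rabs_pos_eq (/ _)) by (left; now apply Rinv_0_lt_compat).
    apply Rmult_le_compat_r; [left; now apply Rinv_0_lt_compat|].
    now apply pochhammer_lipschitz. }
  assert (hex : ex_series (fun n => PS_scal (Rabs (a - a')) (kummer_coef (A + 1) b) n * z ^ n)).
  { apply -> (ex_pseries_R (PS_scal (Rabs (a - a')) (kummer_coef (A + 1) b))).
    apply ex_pseries_scal; [apply Rmult_comm | apply ex]. }
  unfold PSeries.
  apply Rle_trans with (1 := Series_Rabs _
    (@ex_series_le R_AbsRing R_CompleteNormedModule _ _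
       (fun n => Rle_trans _ _ _ (Req_le _ _ (Rabs_Rabsolu _)) (proj2 (hle n))) hex)).
  now apply Series_le.
Qed.

(** The coefficients for A majorize those for a, so a value of [Phi] itself serves as the bound; the
    Lipschitz constants below are built from such values. *)
Lemma Phi_abs_le (a A b z Z : R) : 0 < b -> Rabs a <= A -> Rabs z <= Z ->
  Rabs (Phi a b z) <= Phi A b Z.
Proof.
  intros hb h hz.
  assert (ex : forall c x, ex_pseries (kummer_coef c b) x).
  { intros c x; apply CV_radius_inside; now rewrite kummer_coef_radius. }
  change (Rabs (PSeries (kummer_coef a b) z) <= PSeries (kummer_coef A b) Z).
  assert (hle : forall n, 0 <= Rabs (kummer_coef a b n * z ^ n) <= kummer_coef A b n * Z ^ n).
  { intros n; split; [apply Rabs_pos|].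
    rewrite Rabs_mult; apply Rmult_le_compat; try apply Rabs_pos.
    - now apply kummer_coef_abs_le.
    - rewrite <- RPow_abs; apply pow_incr; split; [apply Rabs_pos | exact hz]. }
  unfold PSeries.
  apply Rle_trans with (1 := Series_Rabs _ (kummer_ex_series a b z hb)).
  apply Series_le; [exact hle | apply -> (ex_pseries_R (kummer_coef A b)); apply ex].
Qed.

Lemma mvt_lower (f df : R -> R) (p q m : R) : p <= q ->
  (forall x, p <= x <= q -> is_derive f x (df x)) ->
  (forall x, p <= x <= q -> m <= df x) -> m * (q - p) <= f q - f p.
Proof.
  intros hpq hd hm.
  destruct (MVT_gen f p q df) as [c [hc e]].
  - intros x; rewrite Rmin_left, Rmax_right by lra; intros hx; apply hd; lra.
  - intros x; rewrite Rmin_left, Rmax_right by lra; intros hx.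
    apply continuity_pt_filterlim, (ex_derive_continuous f); eexists; now apply hd.
  - rewrite Rmin_left, Rmax_right in hc by lra.
    rewrite e; apply Rmult_le_compat_r; [lra | now apply hm].
Qed.

Lemma mvt_upper (f df : R -> R) (p q m : R) : p <= q ->
  (forall x, p <= x <= q -> is_derive f x (df x)) ->
  (forall x, p <= x <= q -> df x <= m) -> f q - f p <= m * (q - p).
Proof.
  intros hpq hd hm.
  assert (h : - m * (q - p) <= - f q - - f p).
  { apply (mvt_lower (fun x => - f x) (fun x => - df x)); [easy | | ].
    - intros x hx; apply (is_derive_opp f); now apply hd.
    - intros x hx; specialize (hm x hx); lra. }
  lra.
Qed.

Lemma Phi_lipschitz_var (a A b z z' Z : R) :
  0 < b -> Rabs a <= A -> Rabs z <= Z -> Rabs z' <= Z ->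
  Rabs (Phi a b z - Phi a b z') <= dPhi A b Z * Rabs (z - z').
Proof.
  intros hb h.
  assert (hd : forall x, Rabs x <= Z -> - dPhi A b Z <= dPhi a b x <= dPhi A b Z).
  { intros x hx; apply Rabs_le_between; unfold dPhi; rewrite Rabs_mult.
    apply Rmult_le_compat; try apply Rabs_pos.
    - rewrite Rabs_div, (Rabs_pos_eq b) by lra.
      apply Rmult_le_compat_r; [left; now apply Rinv_0_lt_compat | exact h].
    - apply Phi_abs_le; [lra| |exact hx].
      apply Rle_trans with (1 := Rabs_triang _ _); rewrite Rabs_R1; lra. }
  assert (hw : forall x y, Rabs x <= Z -> Rabs y <= Z -> x <= y ->
     Rabs (Phi a b y - Phi a b x) <= dPhi A b Z * (y - x)).
  { intros x y hx hy hxy.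
    apply Rabs_le_between in hx; apply Rabs_le_between in hy.
    apply Rabs_le_between; split.
    - rewrite <- Ropp_mult_distr_l_reverse.
      apply (mvt_lower (Phi a b) (dPhi a b)); [easy| |].
      + intros t _; now apply is_derive_Phi.
      + intros t ht; apply hd, Rabs_le_between; lra.
    - apply (mvt_upper (Phi a b) (dPhi a b)); [easy| |].
      + intros t _; now apply is_derive_Phi.
      + intros t ht; apply hd, Rabs_le_between; lra. }
  intros hz hz'; destruct (Rle_lt_dec z' z) as [hc|hc].
  - rewrite (Rabs_pos_eq (z - z')) by lra; now apply hw.
  - rewrite Rabs_minus_sym, (Rabs_minus_sym z), (Rabs_pos_eq (z' - z)) by lra.
    apply hw; lra.
Qed.

Lemma Phi_lipschitz (A b Z : R) : 0 < b ->
  exists L, 0 < L /\ forall a a' z z',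
    Rabs a <= A -> Rabs a' <= A -> 0 <= z <= Z -> 0 <= z' <= Z ->
    Rabs (Phi a b z - Phi a' b z') <= L * (Rabs (a - a') + Rabs (z - z')).
Proof.
  intros hb.
  exists (Rabs (Phi (A + 1) b Z) + Rabs (dPhi A b Z) + 1); split.
  { pose proof (Rabs_pos (Phi (A + 1) b Z)); pose proof (Rabs_pos (dPhi A b Z)); lra. }
  intros a a' z z' ha ha' hz hz'.
  replace (Phi a b z - Phi a' b z')
    with ((Phi a b z - Phi a' b z) + (Phi a' b z - Phi a' b z')) by ring.
  apply Rle_trans with (1 := Rabs_triang _ _).
  pose proof (Phi_lipschitz_param a a' A b z hb ha ha' (proj1 hz)) as h1.
  assert (h2 : Rabs (Phi a' b z - Phi a' b z') <= dPhi A b Z * Rabs (z - z')).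
  { apply Phi_lipschitz_var; try assumption; rewrite Rabs_pos_eq; lra. }
  assert (h3 : Phi (A + 1) b z <= Rabs (Phi (A + 1) b Z)).
  { apply Rle_trans with (1 := Rle_abs _), Rle_trans with (2 := Rle_abs _).
    pose proof (Rabs_pos a).
    apply Phi_abs_le; [easy | rewrite Rabs_pos_eq; lra | rewrite Rabs_pos_eq; lra]. }
  pose proof (Rle_abs (dPhi A b Z)) as h4.
  pose proof (Rabs_pos (a - a')); pose proof (Rabs_pos (z - z')).
  pose proof (Rabs_pos (Phi (A + 1) b Z)); pose proof (Rabs_pos (dPhi A b Z)).
  apply (Rmult_le_compat_l _ _ _ (Rabs_pos (a - a'))) in h3.
  apply (Rmult_le_compat_r _ _ _ (Rabs_pos (z - z'))) in h4.
  nra.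
Qed.

Lemma dPhi_lipschitz (A b Z : R) : 0 < b ->
  exists L, 0 < L /\ forall a a' z z',
    Rabs a <= A -> Rabs a' <= A -> 0 <= z <= Z -> 0 <= z' <= Z ->
    Rabs (dPhi a b z - dPhi a' b z') <= L * (Rabs (a - a') + Rabs (z - z')).
Proof.
  intros hb.
  destruct (Phi_lipschitz (A + 1) (b + 1) Z ltac:(lra)) as [L [hL hLip]].
  set (M := Rabs (Phi (A + 1) (b + 1) Z)).
  assert (hM : 0 <= M) by apply Rabs_pos.
  exists (Rabs A / b * L + M / b + 1); split.
  { assert (0 <= Rabs A / b) by (apply Rdiv_le_0_compat; [apply Rabs_pos | easy]).
    assert (0 <= M / b) by (now apply Rdiv_le_0_compat). nra. }
  intros a a' z z' ha ha' hz hz'.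
  assert (hs : forall c, Rabs c <= A -> Rabs (c + 1) <= A + 1).
  { intros c hc; apply Rle_trans with (1 := Rabs_triang _ _); rewrite Rabs_R1; lra. }
  unfold dPhi.
  replace (a / b * Phi (a + 1) (b + 1) z - a' / b * Phi (a' + 1) (b + 1) z')
    with (/ b * (a * (Phi (a + 1) (b + 1) z - Phi (a' + 1) (b + 1) z')
          + (a - a') * Phi (a' + 1) (b + 1) z')) by (field; lra).
  rewrite Rabs_mult, (Rabs_pos_eq (/ b)) by (left; now apply Rinv_0_lt_compat).
  replace ((Rabs A / b * L + M / b + 1) * (Rabs (a - a') + Rabs (z - z')))
    with (/ b * ((Rabs A * L + M + b) * (Rabs (a - a') + Rabs (z - z')))) by (field; lra).
  apply Rmult_le_compat_l; [left; now apply Rinv_0_lt_compat|].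
  apply Rle_trans with (1 := Rabs_triang _ _); rewrite !Rabs_mult.
  pose proof (hLip (a + 1) (a' + 1) z z' (hs a ha) (hs a' ha') hz hz') as h1.
  replace (a + 1 - (a' + 1)) with (a - a') in h1 by ring.
  assert (h2 : Rabs (Phi (a' + 1) (b + 1) z') <= M).
  { apply Rle_trans with (2 := Rle_abs _).
    apply Phi_abs_le; [lra | now apply hs | rewrite Rabs_pos_eq; lra]. }
  assert (h3 : Rabs a <= Rabs A) by (apply Rle_trans with (2 := Rle_abs _); lra).
  pose proof (Rabs_pos (a - a')); pose proof (Rabs_pos (z - z')); pose proof (Rabs_pos a).
  pose proof (Rmult_le_compat _ _ _ _ (Rabs_pos a) (Rabs_pos _) h3 h1).
  pose proof (Rmult_le_compat_l _ _ _ (Rabs_pos (a - a')) h2).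
  nra.
Qed.

Lemma continuous_Phi (a b z : R) : 0 < b -> continuity_pt (Phi a b) z.
Proof.
  intros hb; apply continuity_pt_filterlim, (ex_derive_continuous (Phi a b)).
  eexists; now apply is_derive_Phi.
Qed.

Lemma Phi_near_0 (a b : R) : 0 < b ->
  exists d, 0 < d /\ forall z, 0 <= z <= d -> 1 / 2 < Phi a b z.
Proof.
  intros hb.
  destruct (Phi_lipschitz (Rabs a) b 1 hb) as [L [hL h]].
  exists (Rmin 1 (/ (4 * L))).
  assert (h4 : 0 < / (4 * L)) by (apply Rinv_0_lt_compat; lra).
  split; [apply Rmin_glb_lt; lra|].
  intros z hz; pose proof (Rmin_l 1 (/ (4 * L))); pose proof (Rmin_r 1 (/ (4 * L))).
  specialize (h a a z 0 (Rle_refl _) (Rle_refl _) ltac:(lra) ltac:(lra)).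
  rewrite Phi_at_0, Rminus_diag, Rabs_R0, Rminus_0_r, (Rabs_pos_eq z) in h by lra.
  apply Rabs_le_between in h.
  assert (L * z <= L * / (4 * L)) by (apply Rmult_le_compat_l; lra).
  replace (L * / (4 * L)) with (1 / 4) in * by (field; lra); lra.
Qed.

(* Backward Gronwall estimate for the energy w^2 + w'^2. *)
Lemma Phi_simple_zero (a b z : R) :
  0 < b -> 0 < z -> Phi a b z = 0 -> dPhi a b z <> 0.
Proof.
  intros hb hz h0 h1.
  destruct (Phi_near_0 a b hb) as [d [hd hpos]].
  set (x0 := Rmin d z).
  assert (hx0 : 0 < x0) by now apply Rmin_glb_lt.
  assert (hx0d : x0 <= d) by apply Rmin_l.
  assert (hx0z : x0 <= z) by apply Rmin_r.
  (* The equation is singular at 0, so the energy is followed on [x0, z] only. There x C >= z + |a|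
     + 2b, which absorbs the terms 2 x w w', 2 a w w' and -2 b w'^2, so E is nondecreasing. A double
     zero at z gives E z = 0, whereas E x0 > 0. *)
  set (C := (z + Rabs a + 2 * b) / x0).
  set (E := fun x => (Phi a b x ^ 2 + dPhi a b x ^ 2) * exp (C * x)).
  assert (hE : 0 * (z - x0) <= E z - E x0).
  { apply (mvt_lower E (fun x => (2 * Phi a b x * dPhi a b x + 2 * dPhi a b x * d2Phi a b x
                     + C * (Phi a b x ^ 2 + dPhi a b x ^ 2)) * exp (C * x))); [easy| |].
    - intros x _; unfold E.
      pose proof (is_derive_Phi a b x hb) as e1; pose proof (is_derive_dPhi a b x hb) as e2.
      auto_derive; [repeat split; eexists; eassumption|].
      change (fun x0 => Phi a b x0) with (Phi a b).
      change (fun x0 => dPhi a b x0) with (dPhi a b).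
      rewrite (is_derive_unique _ _ _ e1), (is_derive_unique _ _ _ e2); ring.
    - intros x hx; apply Rmult_le_pos; [|left; apply exp_pos].
      pose proof (kummer_ode a b x hb) as ode.
      apply Rmult_le_reg_l with x; [lra|].
      set (w := Phi a b x) in *; set (w1 := dPhi a b x) in *; set (w2 := d2Phi a b x) in *.
      replace (x * (2 * w * w1 + 2 * w1 * w2 + C * (w ^ 2 + w1 ^ 2)))
        with (2 * x * w * w1 + 2 * w1 * (a * w - (b - x) * w1) + x * C * (w ^ 2 + w1 ^ 2))
        by (rewrite <- ode; ring).
      assert (hC : z + Rabs a + 2 * b <= x * C).
      { replace (z + Rabs a + 2 * b) with (x0 * C) by (unfold C; field; lra).
        apply Rmult_le_compat_r; [|lra].
        apply Rdiv_le_0_compat; [pose proof (Rabs_pos a); lra | easy]. }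
      assert (ha : - Rabs a <= a <= Rabs a).
      { pose proof (Rle_abs a); pose proof (Rle_abs (- a)) as hq; rewrite Rabs_Ropp in hq; lra. }
      set (q := Rabs a) in *; set (k := x * C) in *.
      assert (hs : 0 <= w ^ 2 + w1 ^ 2) by (pose proof (pow2_ge_0 w); pose proof (pow2_ge_0 w1); lra).
      assert ((z + q + 2 * b) * (w ^ 2 + w1 ^ 2) <= k * (w ^ 2 + w1 ^ 2))
        by now apply Rmult_le_compat_r.
      assert (- (x * (w ^ 2 + w1 ^ 2)) <= 2 * x * w * w1).
      { assert (0 <= x * (w + w1) ^ 2) by (apply Rmult_le_pos; [lra | apply pow2_ge_0]). lra. }
      assert (- (q * (w ^ 2 + w1 ^ 2)) <= 2 * a * w * w1).
      { assert (0 <= (q + a) * (w + w1) ^ 2) by (apply Rmult_le_pos; [lra | apply pow2_ge_0]).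
        assert (0 <= (q - a) * (w - w1) ^ 2) by (apply Rmult_le_pos; [lra | apply pow2_ge_0]). lra. }
      assert (0 <= (z - x) * (w ^ 2 + w1 ^ 2)) by (apply Rmult_le_pos; lra).
      assert (0 <= x * w1 ^ 2) by (apply Rmult_le_pos; [lra | apply pow2_ge_0]).
      assert (0 <= b * w ^ 2) by (apply Rmult_le_pos; [lra | apply pow2_ge_0]).
      lra. }
  unfold E in hE; rewrite h0, h1 in hE.
  specialize (hpos x0 ltac:(lra)).
  assert (0 < (Phi a b x0 ^ 2 + dPhi a b x0 ^ 2) * exp (C * x0)).
  { apply Rmult_lt_0_compat; [nra | apply exp_pos]. }
  replace ((0 ^ 2 + 0 ^ 2) * exp (C * z)) with 0 in hE by ring; lra.
Qed.

(** * Wronskian of rescaled solutions *)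

(* Wronskian, with respect to [ln z], of the Liouville normal forms
   [z^((b-1)/2) e^(-z/2) Phi a b z] and [z^((b-1)/2) e^(-l z/2) Phi a' b (l z)]. *)
Definition kummer_wronskian (a a' b l z : R) : R :=
  exp (b * ln z - (1 + l) / 2 * z)
  * (Phi a' b (l * z) * dPhi a b z - l * Phi a b z * dPhi a' b (l * z)
     - (1 - l) / 2 * Phi a b z * Phi a' b (l * z)).

(* Difference of the coefficients of the two normal forms, divided by [z]. *)
Definition qdiff (a a' b l z : R) : R :=
  ((1 - l ^ 2) * z + 2 * (l * (b - 2 * a') - (b - 2 * a))) / 4.

(** Lagrange's identity: the derivative of the Wronskian of two normal forms is the difference of
    their coefficients times their product. The exponential is the product of the two Liouville
    factors and of the z that comes from differentiating in ln z. *)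
Lemma is_derive_kummer_wronskian (a a' b l z : R) : 0 < b -> 0 < z ->
  is_derive (kummer_wronskian a a' b l) z
    (exp (b * ln z - (1 + l) / 2 * z) / z * qdiff a a' b l z
     * (Phi a' b (l * z) * Phi a b z)).
Proof.
  intros hb hz; unfold kummer_wronskian, qdiff.
  pose proof (is_derive_Phi a b z hb) as e1; pose proof (is_derive_dPhi a b z hb) as e2.
  pose proof (is_derive_Phi a' b (l * z) hb) as e3.
  pose proof (is_derive_dPhi a' b (l * z) hb) as e4.
  auto_derive; [repeat split; try (eexists; eassumption); easy|].
  change (fun x => Phi a b x) with (Phi a b).
  change (fun x => dPhi a b x) with (dPhi a b).
  change (fun x => Phi a' b x) with (Phi a' b).
  change (fun x => dPhi a' b x) with (dPhi a' b).
  rewrite (is_derive_unique _ _ _ e1), (is_derive_unique _ _ _ e2),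
    (is_derive_unique _ _ _ e3), (is_derive_unique _ _ _ e4).
  pose proof (kummer_ode a b z hb) as o1; pose proof (kummer_ode a' b (l * z) hb) as o2.
  set (X := exp (b * ln z - (1 + l) / 2 * z)).
  change (exp (b * ln z + - ((1 + l) / 2 * z))) with X.
  assert (o1' : d2Phi a b z = (a * Phi a b z - (b - z) * dPhi a b z) / z)
    by (rewrite <- o1; field; lra).
  assert (o2' : l * d2Phi a' b (l * z)
     = (a' * Phi a' b (l * z) - (b - l * z) * dPhi a' b (l * z)) / z)
    by (rewrite <- o2; field; lra).
  rewrite o1'.
  match goal with |- ?G = _ => replace G with
    (X * (b / z - (1 + l) / 2)
      * (Phi a' b (l * z) * dPhi a b z - l * Phi a b z * dPhi a' b (l * z)
         - (1 - l) / 2 * Phi a b z * Phi a' b (l * z))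
     + X * (l * dPhi a' b (l * z) * dPhi a b z
        + Phi a' b (l * z) * ((a * Phi a b z - (b - z) * dPhi a b z) / z)
        - l * dPhi a b z * dPhi a' b (l * z)
        - l * Phi a b z * (l * d2Phi a' b (l * z))
        - (1 - l) / 2 * dPhi a b z * Phi a' b (l * z)
        - (1 - l) / 2 * Phi a b z * (l * dPhi a' b (l * z)))) by (field; lra) end.
  rewrite o2'; field; lra.
Qed.

Lemma exp_nondecreasing (x y : R) : x <= y -> exp x <= exp y.
Proof. intros [h | ->]; [left; now apply exp_increasing | apply Rle_refl]. Qed.

(** The weight z^b tends to 0 while the bracket stays bounded. The limit is expressed through small
    z > 0, because [ln 0 = 0] makes the weight equal to 1 at z = 0. *)
Lemma kummer_wronskian_small_at_0 (a a' b l x eta : R) : 0 < b -> 0 < l -> 0 < x -> 0 < eta ->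
  exists z, 0 < z < x /\ Rabs (kummer_wronskian a a' b l z) < eta.
Proof.
  intros hb hl hx heta.
  set (br := fun z => Phi a' b (l * z) * dPhi a b z - l * Phi a b z * dPhi a' b (l * z)
     - (1 - l) / 2 * Phi a b z * Phi a' b (l * z)).
  assert (hc : continuous br 0).
  { apply (ex_derive_continuous br).
    pose proof (is_derive_Phi a b 0 hb); pose proof (is_derive_dPhi a b 0 hb).
    pose proof (is_derive_Phi a' b (l * 0) hb); pose proof (is_derive_dPhi a' b (l * 0) hb).
    unfold br; auto_derive; repeat split; eexists; eassumption. }
  apply continuity_pt_filterlim in hc.
  destruct (hc 1 Rlt_0_1) as [d [hd hbr]].
  set (M := Rabs (br 0) + 1).
  assert (hM : 0 < M) by (pose proof (Rabs_pos (br 0)); unfold M; lra).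
  assert (hq : 0 < eta / (2 * M)) by (apply Rdiv_lt_0_compat; lra).
  (* This is the b-th root of eta / (2M), so z <= z1 gives z^b <= eta / (2M). *)
  set (z1 := exp (ln (eta / (2 * M)) / b)).
  assert (hz1 : 0 < z1) by apply exp_pos.
  set (z := Rmin (x / 2) (Rmin (d / 2) z1)).
  assert (hz : 0 < z) by (repeat apply Rmin_glb_lt; lra).
  assert (h1 : z <= x / 2) by apply Rmin_l.
  assert (h2 : z <= d / 2) by (apply Rle_trans with (1 := Rmin_r _ _), Rmin_l).
  assert (h3 : z <= z1) by (apply Rle_trans with (1 := Rmin_r _ _), Rmin_r).
  exists z; split; [lra|].
  change (kummer_wronskian a a' b l z) with (exp (b * ln z - (1 + l) / 2 * z) * br z).
  rewrite Rabs_mult, Rabs_pos_eq by (left; apply exp_pos).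
  assert (he : exp (b * ln z - (1 + l) / 2 * z) <= eta / (2 * M)).
  { rewrite <- (exp_ln (eta / (2 * M))) by easy.
    assert (hln : ln z <= ln (eta / (2 * M)) / b).
    { rewrite <- (ln_exp (ln (eta / (2 * M)) / b)); now apply ln_le. }
    apply exp_nondecreasing.
    apply (Rmult_le_compat_l b) in hln; [|lra].
    replace (b * (ln (eta / (2 * M)) / b)) with (ln (eta / (2 * M))) in hln by (field; lra).
    assert (0 <= (1 + l) / 2 * z) by (apply Rmult_le_pos; lra); lra. }
  assert (hb2 : Rabs (br z) <= M).
  { assert (h : Rabs (br z - br 0) < 1).
    { apply (hbr z); split; [split; [exact I | lra]|].
      simpl; unfold Rdist; rewrite Rminus_0_r, Rabs_pos_eq; lra. }
    pose proof (Rabs_triang (br z - br 0) (br 0)) as ht.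
    replace (br z - br 0 + br 0) with (br z) in ht by ring; unfold M; lra. }
  apply Rle_lt_trans with (eta / (2 * M) * M).
  - apply Rmult_le_compat; try easy; [left; apply exp_pos | apply Rabs_pos].
  - replace (eta / (2 * M) * M) with (eta / 2) by (field; lra); lra.
Qed.

Lemma mvt_strict (f df : R -> R) (p q : R) : p < q ->
  (forall x, p <= x <= q -> is_derive f x (df x)) ->
  (forall x, p < x < q -> 0 < df x) -> f p < f q.
Proof.
  intros hpq hd hpos.
  destruct (MVT_cor2 f df p q hpq) as [c [e hc]].
  - intros c hc; apply is_derive_Reals; now apply hd.
  - specialize (hpos c hc).
    assert (0 < df c * (q - p)) by (apply Rmult_lt_0_compat; lra); lra.
Qed.

(** The multiple s W of the Wronskian is strictly increasing on (0, x] and starts from the limit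
    0. *)
Lemma kummer_wronskian_sign (s a a' b l x : R) : 0 < b -> 0 < l -> 0 < x ->
  (forall z, 0 < z < x -> 0 < s * qdiff a a' b l z * (Phi a' b (l * z) * Phi a b z)) ->
  0 < s * kummer_wronskian a a' b l x.
Proof.
  intros hb hl hx hpos.
  set (f := fun z => s * kummer_wronskian a a' b l z).
  assert (hmono : forall p q, 0 < p < q -> q <= x -> f p < f q).
  { intros p q hp hq.
    apply (mvt_strict f (fun z => s * (exp (b * ln z - (1 + l) / 2 * z) / z * qdiff a a' b l z
     * (Phi a' b (l * z) * Phi a b z)))); [lra| |].
    - intros z hz; apply (is_derive_scal (kummer_wronskian a a' b l)), is_derive_kummer_wronskian; lra.
    - intros z hz.
      replace (s * (exp (b * ln z - (1 + l) / 2 * z) / z * qdiff a a' b l z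
         * (Phi a' b (l * z) * Phi a b z)))
        with (exp (b * ln z - (1 + l) / 2 * z) / z
         * (s * qdiff a a' b l z * (Phi a' b (l * z) * Phi a b z))) by (field; lra).
      apply Rmult_lt_0_compat; [apply Rdiv_lt_0_compat; [apply exp_pos | lra]|].
      apply hpos; lra. }
  change (0 < f x).
  destruct (Rlt_le_dec 0 (f x)) as [h|h]; [easy|exfalso].
  (* Going back to x / 2 makes the value strictly negative; by monotonicity it then stays below a
     fixed negative number near 0, against the smallness of W there. *)
  pose proof (hmono (x / 2) x ltac:(lra) ltac:(lra)) as h1.
  assert (hs : 0 < Rabs s + 1) by (pose proof (Rabs_pos s); lra).
  destruct (kummer_wronskian_small_at_0 a a' b l (x / 2) (- f (x / 2) / (Rabs s + 1)))
    as [z [hz hw]]; try easy; [lra|apply Rdiv_lt_0_compat; lra|].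
  pose proof (hmono z (x / 2) ltac:(lra) ltac:(lra)) as h2.
  assert (h3 : Rabs (f z) <= - f (x / 2)).
  { unfold f at 1; rewrite Rabs_mult.
    replace (- f (x / 2)) with ((Rabs s + 1) * (- f (x / 2) / (Rabs s + 1))) by (field; lra).
    apply Rmult_le_compat; try apply Rabs_pos; lra. }
  apply Rabs_le_between in h3; lra.
Qed.

(* The positive contribution to the Wronskian near [0] beats the error made by replacing
   [Phi a' b (l z) * Phi a b z] by the nonnegative [Phi a b z ^ 2] elsewhere. *)
Lemma local_sturm (a b z0 K k0 : R) :
  0 < b -> 0 < z0 -> 0 < k0 -> Phi a b z0 = 0 ->
  exists r, 0 < r /\ forall a' l eps (kap : R -> R),
    Rabs (a' - a) < r -> 1 - r < l <= 1 -> eps <> 0 ->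
    (forall z, 0 < z <= z0 -> qdiff a a' b l z = eps * kap z) ->
    (forall z, 0 < z <= z0 -> 0 <= kap z <= K) ->
    (forall z, 0 < z <= z0 / 2 -> k0 <= kap z) ->
    0 < eps * (Phi a' b (l * z0) * dPhi a b z0).
Proof.
  intros hb hz0 hk0 hzero.
  destruct (Phi_near_0 a b hb) as [d [hd hnear]].
  destruct (Phi_lipschitz (Rabs a + 1) b z0 hb) as [L [hL hLip]].
  (* On (0, d0] both Phi a b > 1/2 and kap >= k0 hold. The lower bound on kap is asked for only up
     to z0 / 2, so that kap may vanish at z0. *)
  set (d0 := Rmin d (z0 / 2)).
  assert (hd0 : 0 < d0) by (apply Rmin_glb_lt; lra).
  assert (hd0d : d0 <= d) by apply Rmin_l.
  assert (hd0z : d0 <= z0 / 2) by apply Rmin_r.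
  set (M := Phi (Rabs a) b z0).
  assert (hM : forall z, 0 <= z <= z0 -> Rabs (Phi a b z) <= M).
  { intros z hz; apply Phi_abs_le; [easy | apply Rle_refl | rewrite Rabs_pos_eq; lra]. }
  assert (hM0 : 0 <= M) by (apply Rle_trans with (2 := hM 0 ltac:(lra)), Rabs_pos).
  (* m0 bounds weight times kap from below on [d0 / 2, d0]; M1 below bounds it from above on
     [d0, z0]. *)
  set (m0 := exp (b * ln (d0 / 2) - z0) / z0 * k0).
  assert (hm0 : 0 < m0).
  { apply Rmult_lt_0_compat; [apply Rdiv_lt_0_compat; [apply exp_pos | easy] | easy]. }
  set (M1 := exp (b * ln z0) / d0 * Rabs K).
  assert (hM1 : 0 <= M1).
  { apply Rmult_le_pos; [|apply Rabs_pos].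
    apply Rdiv_le_0_compat; [left; apply exp_pos | easy]. }
  (* The interval [d0 / 2, d0] gains at least m0 (1/8) (d0 / 2) = m0 d0 / 16. The factor 32 keeps
     the loss M1 eta M z0 on [d0, z0] below half of that. *)
  set (D := 32 * (M1 * M * z0 + 1)).
  assert (hMM : 0 <= M1 * M * z0) by (apply Rmult_le_pos; [now apply Rmult_le_pos | lra]).
  set (eta := Rmin (1 / 4) (m0 * d0 / D)).
  assert (heta : 0 < eta).
  { apply Rmin_glb_lt; [lra|].
    apply Rdiv_lt_0_compat; [now apply Rmult_lt_0_compat | unfold D; lra]. }
  assert (heta1 : eta <= 1 / 4) by apply Rmin_l.
  assert (heta2 : eta * D <= m0 * d0).
  { apply Rle_div_r; [unfold D; lra | apply Rmin_r]. }
  (* By the Lipschitz bound this makes Phi a' b (l z) differ from Phi a b z by at most eta. It does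
     not involve eps, which may therefore be arbitrarily small. *)
  set (r := Rmin (1 / 2) (eta / (L * (1 + z0)))).
  assert (hLz : 0 < L * (1 + z0)) by (apply Rmult_lt_0_compat; lra).
  assert (hr : 0 < r) by (apply Rmin_glb_lt; [lra | now apply Rdiv_lt_0_compat]).
  assert (hr1 : r <= 1 / 2) by apply Rmin_l.
  assert (hr2 : r * (L * (1 + z0)) <= eta) by (apply Rle_div_r; [easy | apply Rmin_r]).
  exists r; split; [easy|].
  intros a' l eps kap ha' hl heps hq hkap hkap0.
  assert (hv : forall z, 0 <= z <= z0 -> Rabs (Phi a' b (l * z) - Phi a b z) <= eta).
  { intros z hz.
    assert (hlz : 0 <= l * z <= z0) by nra.
    apply Rle_trans with (2 := hr2).
    eapply Rle_trans.
    - apply hLip; try easy; [|lra].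
      pose proof (Rabs_triang (a' - a) a) as ht.
      replace (a' - a + a) with a' in ht by ring; lra.
    - replace (r * (L * (1 + z0))) with (L * (r + r * z0)) by ring.
      apply Rmult_le_compat_l; [lra|].
      apply Rplus_le_compat; [lra|].
      rewrite Rabs_minus_sym, Rabs_pos_eq by nra; nra. }
  assert (hnear' : forall z, 0 < z <= d0 -> 1 / 8 <= Phi a' b (l * z) * Phi a b z).
  { intros z hz.
    specialize (hv z ltac:(lra)); specialize (hnear z ltac:(lra)).
    apply Rabs_le_between in hv; nra. }
  assert (hfar : forall z, 0 < z <= z0 -> - (eta * M) <= Phi a' b (l * z) * Phi a b z).
  { intros z hz; specialize (hv z ltac:(lra)); specialize (hM z ltac:(lra)).
    replace (Phi a' b (l * z) * Phi a b z)
      with ((Phi a' b (l * z) - Phi a b z) * Phi a b z + Phi a b z ^ 2) by ring.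
    assert (h : Rabs ((Phi a' b (l * z) - Phi a b z) * Phi a b z) <= eta * M).
    { rewrite Rabs_mult; apply Rmult_le_compat; try apply Rabs_pos; easy. }
    apply Rabs_le_between in h; pose proof (pow2_ge_0 (Phi a b z)); lra. }
  (* Division by eps leaves the nonnegative factor kap in the derivative, whatever the sign of
     eps. *)
  set (U := fun z => / eps * kummer_wronskian a a' b l z).
  set (dU := fun z => exp (b * ln z - (1 + l) / 2 * z) / z * kap z
                      * (Phi a' b (l * z) * Phi a b z)).
  assert (hU : forall z, 0 < z <= z0 -> is_derive U z (dU z)).
  { intros z hz.
    replace (dU z) with (/ eps * (exp (b * ln z - (1 + l) / 2 * z) / z * qdiff a a' b l z
      * (Phi a' b (l * z) * Phi a b z))).
    - apply (is_derive_scal (kummer_wronskian a a' b l)), is_derive_kummer_wronskian; lra.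
    - unfold dU; rewrite hq by easy; field; lra. }
  assert (h1 : 0 < U (d0 / 2)).
  { apply kummer_wronskian_sign; try easy; [lra|lra|].
    intros z hz; rewrite hq by lra.
    replace (/ eps * (eps * kap z)) with (kap z) by (field; easy).
    specialize (hkap0 z ltac:(lra)); specialize (hnear' z ltac:(lra)).
    apply Rmult_lt_0_compat; lra. }
  assert (h2 : m0 * (1 / 8) * (d0 - d0 / 2) <= U d0 - U (d0 / 2)).
  { apply (mvt_lower U dU); [lra| |].
    - intros z hz; apply hU; lra.
    - intros z hz; unfold dU.
      apply Rmult_le_compat; [lra | lra | | apply hnear'; lra].
      apply Rmult_le_compat; [|lra| |apply hkap0; lra].
      + apply Rdiv_le_0_compat; [left; apply exp_pos | easy].
      + apply Rmult_le_compat; [left; apply exp_pos | left; now apply Rinv_0_lt_compat | |].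
        * apply exp_nondecreasing.
          assert (ln (d0 / 2) <= ln z) by (apply ln_le; lra).
          nra.
        * apply Rinv_le_contravar; lra. }
  assert (h3 : - (M1 * (eta * M)) * (z0 - d0) <= U z0 - U d0).
  { apply (mvt_lower U dU); [lra| |].
    - intros z hz; apply hU; lra.
    - intros z hz; unfold dU.
      set (wt := exp (b * ln z - (1 + l) / 2 * z) / z * kap z).
      assert (hwt : 0 <= wt <= M1).
      { split.
        - apply Rmult_le_pos; [|apply hkap; lra].
          apply Rdiv_le_0_compat; [left; apply exp_pos | lra].
        - apply Rmult_le_compat.
          + apply Rdiv_le_0_compat; [left; apply exp_pos | lra].
          + apply hkap; lra.
          + apply Rmult_le_compat; [left; apply exp_pos | left; apply Rinv_0_lt_compat; lra | |].
            * apply exp_nondecreasing.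
              assert (ln z <= ln z0) by (apply ln_le; lra).
              nra.
            * apply Rinv_le_contravar; lra.
          + apply Rle_trans with K; [apply hkap; lra | apply Rle_abs]. }
      specialize (hfar z ltac:(lra)).
      assert (0 <= eta * M) by (apply Rmult_le_pos; lra).
      assert (wt * - (eta * M) <= wt * (Phi a' b (l * z) * Phi a b z))
        by (apply Rmult_le_compat_l; lra).
      assert (wt * (eta * M) <= M1 * (eta * M)) by (apply Rmult_le_compat_r; lra).
      lra. }
  assert (h4 : 0 < U z0).
  { assert (M1 * (eta * M) * (z0 - d0) <= M1 * (eta * M) * z0).
    { apply Rmult_le_compat_l; [|lra].
      apply Rmult_le_pos; [easy | apply Rmult_le_pos; lra]. }
    unfold D in heta2; nra. }
  (* Since Phi a b z0 = 0, only the first term of the Wronskian remains at z0. *)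
  unfold U, kummer_wronskian in h4; rewrite hzero in h4.
  set (X := exp (b * ln z0 - (1 + l) / 2 * z0)) in h4.
  assert (hX : 0 < X) by apply exp_pos.
  replace (eps * (Phi a' b (l * z0) * dPhi a b z0)) with
    (eps ^ 2 / X * (/ eps * (X * (Phi a' b (l * z0) * dPhi a b z0 - l * 0 * dPhi a' b (l * z0)
       - (1 - l) / 2 * 0 * Phi a' b (l * z0))))) by (field; split; lra).
  apply Rmult_lt_0_compat; [|exact h4].
  apply Rdiv_lt_0_compat; [|easy].
  now apply pow2_gt_0.
Qed.

(** * Zeros in the variable z *)

Lemma continuity_pt_pos_nbhd (f : R -> R) (x : R) : continuity_pt f x -> 0 < f x ->
  exists d, 0 < d /\ forall t, Rabs (t - x) < d -> 0 < f t.
Proof.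
  intros hc hx.
  destruct (hc (f x) hx) as [d [hd h]]; exists d; split; [easy|].
  intros t ht; destruct (Req_dec t x) as [->|hne]; [easy|].
  assert (h1 : Rabs (f t - f x) < f x).
  { apply (h t); split; [split; [exact I | now apply not_eq_sym] | exact ht]. }
  apply Rabs_lt_between in h1; lra.
Qed.

Lemma continuity_pt_nonneg_left (f : R -> R) (p x : R) : continuity_pt f x -> p < x ->
  (forall t, p < t < x -> 0 <= f t) -> 0 <= f x.
Proof.
  intros hc hpx hpos; destruct (Rle_lt_dec 0 (f x)) as [h|h]; [easy|exfalso].
  destruct (continuity_pt_pos_nbhd (fun t => - f t) x) as [d [hd hn]];
    [now apply continuity_pt_opp | lra |].
  set (t := Rmax ((p + x) / 2) (x - d / 2)).
  assert (ht : p < t < x).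
  { split; [apply Rlt_le_trans with (2 := Rmax_l _ _); lra|apply Rmax_lub_lt; lra]. }
  assert (x - d / 2 <= t) by apply Rmax_r.
  specialize (hpos t ht).
  specialize (hn t ltac:(apply Rabs_lt_between; lra)); lra.
Qed.

Lemma last_zero (f : R -> R) (p q : R) : p <= q -> continuity f -> f p = 0 ->
  exists y, p <= y <= q /\ f y = 0 /\ forall x, y < x <= q -> f x <> 0.
Proof.
  intros hpq hc hp.
  destruct (completeness (fun x => p <= x <= q /\ f x = 0)) as [m [hub hlub]].
  - exists q; intros x [hx _]; lra.
  - exists p; split; [lra | easy].
  - assert (hm : p <= m <= q).
    { split; [apply hub; split; [lra | easy]|].
      apply hlub; intros x [hx _]; lra. }
    exists m; split; [easy|]; split.
    + destruct (Req_dec (f m) 0) as [h|h]; [easy|exfalso].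
      destruct (continuity_pt_pos_nbhd (fun t => f t * f t) m) as [d [hd hn]].
      * apply continuity_pt_mult; apply hc.
      * nra.
      * assert (hle : m <= m - d).
        { apply hlub; intros x [hx hfx].
          destruct (Rle_lt_dec x (m - d)) as [hxd|hxd]; [easy|exfalso].
          assert (x <= m) by (apply hub; now split).
          specialize (hn x ltac:(apply Rabs_lt_between; lra)).
          rewrite hfx in hn; lra. }
        lra.
    + intros x hx hfx.
      assert (x <= m) by (apply hub; split; [lra | easy]); lra.
Qed.

Lemma first_zero (f : R -> R) (p q : R) : p <= q -> continuity f -> f q = 0 ->
  exists y, p <= y <= q /\ f y = 0 /\ forall x, p <= x < y -> f x <> 0.
Proof.
  intros hpq hc hq.
  destruct (last_zero (fun x => f (- x)) (- q) (- p)) as [y [hy [hfy hn]]].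
  - lra.
  - intros x; apply (continuity_pt_comp Ropp f); [apply continuity_pt_opp, continuity_pt_id | apply hc].
  - now rewrite Ropp_involutive.
  - exists (- y); split; [lra|]; split; [easy|].
    intros x hx; rewrite <- (Ropp_involutive x); apply hn; lra.
Qed.

Lemma no_sign_change (f : R -> R) (p q : R) : continuity f ->
  (forall x, p < x < q -> f x <> 0) ->
  forall x y, p < x < q -> p < y < q -> 0 < f x -> 0 < f y.
Proof.
  intros hc hn.
  assert (hle : forall x y, p < x < q -> p < y < q -> x <= y -> 0 < f x * f y).
  { intros x y hx hy hxy.
    destruct (Rlt_le_dec 0 (f x * f y)) as [h|h]; [easy|exfalso].
    destruct (IVT_cor f x y hc hxy h) as [z [hz e]].
    apply (hn z); [lra | easy]. }
  intros x y hx hy hfx.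
  destruct (Rle_lt_dec x y) as [h|h].
  - specialize (hle x y hx hy h); nra.
  - specialize (hle y x hy hx ltac:(lra)); nra.
Qed.

(** The sign is a real s with s * s = 1, so one computation covers both signs and s can be cancelled
    algebraically. *)
Lemma constant_sign (f : R -> R) (p q : R) : p < q -> continuity f ->
  (forall x, p < x < q -> f x <> 0) ->
  exists s, s * s = 1 /\ forall x, p < x < q -> 0 < s * f x.
Proof.
  intros hpq hc hn.
  destruct (Rlt_le_dec 0 (f ((p + q) / 2))) as [h|h].
  - exists 1; split; [ring|]; intros x hx; rewrite Rmult_1_l.
    apply (no_sign_change f p q hc hn ((p + q) / 2)); lra.
  - exists (- 1); split; [ring|]; intros x hx.
    apply (no_sign_change (fun t => -1 * f t) p q) with (x := (p + q) / 2); try lra.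
    + now apply continuity_scal.
    + intros t ht; specialize (hn t ht); lra.
    + assert (f ((p + q) / 2) <> 0) by (apply hn; lra); lra.
Qed.

Lemma derivative_nonpos_left (f : R -> R) (p x l : R) : p < x -> is_derive f x l ->
  (forall t, p < t < x -> 0 <= f t) -> f x = 0 -> l <= 0.
Proof.
  intros hpx hd hpos hx; destruct (Rle_lt_dec l 0) as [h|h]; [easy|exfalso].
  apply is_derive_Reals in hd; destruct (hd l h) as [[d hd0] hlim]; simpl in hlim.
  set (k := Rmin (d / 2) ((x - p) / 2)).
  assert (hk : 0 < k) by (apply Rmin_glb_lt; lra).
  assert (k <= d / 2) by apply Rmin_l; assert (k <= (x - p) / 2) by apply Rmin_r.
  specialize (hlim (- k) ltac:(lra) ltac:(rewrite Rabs_Ropp, Rabs_pos_eq; lra)).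
  specialize (hpos (x + - k) ltac:(lra)).
  rewrite hx, Rminus_0_r in hlim; apply Rabs_lt_between in hlim.
  assert (0 <= f (x + - k) / k) by now apply Rdiv_le_0_compat.
  replace (f (x + - k) / - k) with (- (f (x + - k) / k)) in hlim by (field; lra); lra.
Qed.

Lemma derivative_nonneg_right (f : R -> R) (x q l : R) : x < q -> is_derive f x l ->
  (forall t, x < t < q -> 0 <= f t) -> f x = 0 -> 0 <= l.
Proof.
  intros hxq hd hpos hx.
  assert (h : - l <= 0); [|lra].
  apply (derivative_nonpos_left (fun t => f (- t)) (- q) (- x)).
  - lra.
  - replace (- l) with (scal (- 1) l) by (unfold scal; simpl; unfold mult; simpl; ring).
    apply (is_derive_comp f Ropp); [now rewrite Ropp_involutive|].
    auto_derive; [easy | ring].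
  - intros t ht; apply hpos; lra.
  - now rewrite Ropp_involutive.
Qed.

Lemma simple_zero_isolated (f : R -> R) (x l : R) : is_derive f x l -> f x = 0 -> l <> 0 ->
  exists d, 0 < d /\ forall t, 0 < Rabs (t - x) < d -> f t <> 0.
Proof.
  intros hd hx hl; apply is_derive_Reals in hd.
  destruct (hd (Rabs l) (Rabs_pos_lt _ hl)) as [[d hd0] hlim]; simpl in hlim.
  exists d; split; [easy|]; intros t ht hft.
  specialize (hlim (t - x)).
  replace (x + (t - x)) with t in hlim by ring.
  rewrite hft, hx in hlim.
  assert (h : Rabs ((0 - 0) / (t - x) - l) < Rabs l).
  { apply hlim; [|easy]; intros h0; rewrite h0, Rabs_R0 in ht; lra. }
  replace ((0 - 0) / (t - x) - l) with (- l) in h.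
  - rewrite Rabs_Ropp in h; lra.
  - field; intros h0; rewrite h0, Rabs_R0 in ht; lra.
Qed.

(** Zeros are simple, hence isolated, so a punctured neighbourhood of z is free of zeros and
    [last_zero] can be applied on a closed interval that stops short of z. *)
Lemma Phi_previous_zero (a b x z : R) : 0 < b -> 0 < x < z ->
  Phi a b x = 0 -> Phi a b z = 0 ->
  exists y, 0 < y < z /\ Phi a b y = 0 /\ forall t, y < t < z -> Phi a b t <> 0.
Proof.
  intros hb hx hx0 hz0.
  destruct (simple_zero_isolated (Phi a b) z (dPhi a b z)) as [d [hd hiso]]; try easy.
  { now apply is_derive_Phi. }
  { apply Phi_simple_zero; lra. }
  destruct (last_zero (Phi a b) x (Rmax x (z - d / 2))) as [y [hy [hy0 hn]]].
  - apply Rmax_l.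
  - intros t; now apply continuous_Phi.
  - easy.
  - assert (hyz : y < z) by (apply Rle_lt_trans with (1 := proj2 hy), Rmax_lub_lt; lra).
    exists y; split; [lra|]; split; [easy|].
    intros t ht; destruct (Rle_lt_dec t (Rmax x (z - d / 2))) as [hc|hc].
    + apply hn; lra.
    + apply hiso; pose proof (Rmax_r x (z - d / 2)).
      rewrite Rabs_minus_sym, Rabs_pos_eq; lra.
Qed.

Lemma Phi_pos_before_zeros (a b z : R) : 0 < b ->
  (forall x, 0 < x < z -> Phi a b x <> 0) -> forall x, 0 < x < z -> 0 < Phi a b x.
Proof.
  intros hb hn x hx.
  destruct (Phi_near_0 a b hb) as [d [hd hpos]].
  set (x0 := Rmin d (z / 2)).
  assert (0 < x0) by (apply Rmin_glb_lt; lra).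
  assert (x0 <= d) by apply Rmin_l; assert (x0 <= z / 2) by apply Rmin_r.
  specialize (hpos x0 ltac:(lra)).
  apply (no_sign_change (Phi a b) 0 z) with (x := x0); try easy; try lra.
  intros t; now apply continuous_Phi.
Qed.

Lemma Phi_first_zero (a b z : R) : 0 < b -> 0 < z -> Phi a b z = 0 ->
  exists x, 0 < x <= z /\ Phi a b x = 0 /\ dPhi a b x <= 0
    /\ forall t, 0 < t < x -> 0 < Phi a b t.
Proof.
  intros hb hz h0.
  destruct (first_zero (Phi a b) 0 z) as [x [hx [hx0 hn]]]; try lra.
  { intros t; now apply continuous_Phi. }
  assert (0 < x).
  { destruct (proj1 hx) as [h|h]; [easy|].
    rewrite <- h, Phi_at_0 in hx0; lra. }
  assert (hpos : forall t, 0 < t < x -> 0 < Phi a b t).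
  { apply Phi_pos_before_zeros; [easy|]; intros t ht; apply hn; lra. }
  exists x; split; [lra|]; split; [easy|]; split; [|easy].
  apply (derivative_nonpos_left (Phi a b) 0 x); try easy.
  - now apply is_derive_Phi.
  - intros t ht; left; now apply hpos.
Qed.

(** Sturm comparison with l = 1, where [qdiff] is the constant a - a' < 0. If Phi a b were positive
    on (0, z), the Wronskian would be negative at the first zero x of Phi a' b; but there it is a
    negative multiple of Phi a b x * dPhi a' b x, which is at most 0. *)
Lemma Phi_zero_below (a a' b z : R) : 0 < b -> a < a' -> 0 < z -> Phi a' b z = 0 ->
  exists x, 0 < x < z /\ Phi a b x = 0.
Proof.
  intros hb haa hz h0.
  destruct (classic (exists x, 0 < x < z /\ Phi a b x = 0)) as [h|h]; [easy|exfalso].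
  assert (hpos : forall x, 0 < x < z -> 0 < Phi a b x).
  { apply Phi_pos_before_zeros; [easy|]; intros x hx e; apply h; now exists x. }
  destruct (Phi_first_zero a' b z hb hz h0) as [x [hx [hx0 [hdx hposx]]]].
  assert (hax : 0 <= Phi a b x).
  { apply (continuity_pt_nonneg_left (Phi a b) 0); [now apply continuous_Phi | lra |].
    intros t ht; left; apply hpos; lra. }
  assert (hw : 0 < -1 * kummer_wronskian a a' b 1 x).
  { apply kummer_wronskian_sign; try lra.
    intros t ht; rewrite Rmult_1_l.
    replace (qdiff a a' b 1 t) with (- (a' - a)) by (unfold qdiff; field).
    specialize (hpos t ltac:(lra)); specialize (hposx t ht).
    apply Rmult_lt_0_compat; [lra | now apply Rmult_lt_0_compat]. }
  unfold kummer_wronskian in hw; rewrite Rmult_1_l, hx0 in hw.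
  set (X := exp (b * ln x - (1 + 1) / 2 * x)) in hw.
  assert (hX : 0 < X) by apply exp_pos.
  assert (0 <= X * (Phi a b x * - dPhi a' b x))
    by (apply Rmult_le_pos; [lra | apply Rmult_le_pos; lra]).
  lra.
Qed.

(* The Liouville normal form of Kummer's equation in the variable [ln z]: it solves
   u'' = (z^2 - 2 (b - 2a) z + (b - 1)^2) / 4 * u, and [lnorm1] is u'. *)
Definition lnorm (a b z : R) : R := exp ((b - 1) / 2 * ln z - z / 2) * Phi a b z.

Definition lnorm1 (a b z : R) : R :=
  exp ((b - 1) / 2 * ln z - z / 2) * (z * dPhi a b z + (b - 1 - z) / 2 * Phi a b z).

Lemma is_derive_lnorm (a b z : R) : 0 < b -> 0 < z ->
  is_derive (lnorm a b) z (lnorm1 a b z / z).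
Proof.
  intros hb hz; unfold lnorm, lnorm1.
  pose proof (is_derive_Phi a b z hb) as e1.
  auto_derive; [repeat split; try (eexists; eassumption); easy|].
  change (fun x => Phi a b x) with (Phi a b).
  rewrite (is_derive_unique _ _ _ e1).
  change (exp ((b - 1) / 2 * ln z + - (z * / 2))) with (exp ((b - 1) / 2 * ln z - z / 2)).
  field; lra.
Qed.

Lemma is_derive_lnorm1 (a b z : R) : 0 < b -> 0 < z ->
  is_derive (lnorm1 a b) z
    ((z ^ 2 - 2 * (b - 2 * a) * z + (b - 1) ^ 2) / 4 * lnorm a b z / z).
Proof.
  intros hb hz; unfold lnorm, lnorm1.
  pose proof (is_derive_Phi a b z hb) as e1; pose proof (is_derive_dPhi a b z hb) as e2.
  auto_derive; [repeat split; try (eexists; eassumption); easy|].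
  change (fun x => Phi a b x) with (Phi a b).
  change (fun x => dPhi a b x) with (dPhi a b).
  rewrite (is_derive_unique _ _ _ e1), (is_derive_unique _ _ _ e2).
  replace (d2Phi a b z) with ((a * Phi a b z - (b - z) * dPhi a b z) / z)
    by (rewrite <- (kummer_ode a b z hb); field; lra).
  change (exp ((b - 1) / 2 * ln z + - (z * / 2))) with (exp ((b - 1) / 2 * ln z - z / 2)).
  field; lra.
Qed.

(* Sturm comparison with sin (om ln z + const), where om^2 = discr b a / 4 is the maximum of
   the coefficient of the normal form. *)
Lemma Phi_zero_spacing (a b y z : R) : 0 < b -> 0 < y < z -> 0 < discr b a ->
  Phi a b y = 0 -> Phi a b z = 0 -> (forall t, y < t < z -> Phi a b t <> 0) ->
  g b a * y <= z.
Proof.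
  intros hb hyz hdis hy0 hz0 hn.
  destruct (Rle_lt_dec (g b a * y) z) as [h|h]; [easy|exfalso].
  destruct (constant_sign (Phi a b) y z) as [s [hs hpos]]; try easy; try lra.
  { intros t; now apply continuous_Phi. }
  set (om := sqrt (discr b a) / 2).
  assert (hsq : 0 < sqrt (discr b a)) by now apply sqrt_lt_R0.
  assert (hom : 0 < om) by (unfold om; lra).
  assert (hom2 : om * om = discr b a / 4).
  { unfold om.
    replace (sqrt (discr b a) / 2 * (sqrt (discr b a) / 2))
      with (sqrt (discr b a) * sqrt (discr b a) / 4) by field.
    rewrite sqrt_sqrt; lra. }
  assert (hlen : om * (ln z - ln y) < PI).
  { apply ln_increasing in h; [|lra].
    unfold g in h; rewrite ln_mult, ln_exp in h by (try apply exp_pos; lra).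
    replace PI with (om * (2 * PI / sqrt (discr b a))) by (unfold om; field; lra).
    apply Rmult_lt_compat_l; lra. }
  assert (hlen0 : 0 < om * (ln z - ln y)).
  { apply Rmult_lt_0_compat; [easy|].
    assert (ln y < ln z) by (apply ln_increasing; lra); lra. }
  (* Half of the slack: the phase runs from ep to PI - ep, so the sine is positive at both endpoints
     too. *)
  set (ep := (PI - om * (ln z - ln y)) / 2).
  set (th := fun t => om * (ln t - ln y) + ep).
  assert (hth : forall t, y <= t <= z -> 0 < sin (th t)).
  { intros t ht.
    assert (ln y <= ln t) by (apply ln_le; lra).
    assert (ln t <= ln z) by (apply ln_le; lra).
    assert (0 <= om * (ln t - ln y)) by (apply Rmult_le_pos; lra).
    assert (om * (ln t - ln y) <= om * (ln z - ln y)) by (apply Rmult_le_compat_l; lra).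
    apply sin_gt_0; unfold th, ep; lra. }
  (* The Wronskian of the normal form and the sine, times s. It is nonincreasing, because adding
     om^2 to the coefficient completes the square (t - (b - 2a))^2 / 4; yet its boundary values
     satisfy N y < 0 <= N z. *)
  set (N := fun t => s * (om * cos (th t) * lnorm a b t - sin (th t) * lnorm1 a b t)).
  assert (hN : N z - N y <= 0 * (z - y)).
  { apply (mvt_upper N (fun t => - ((t - (b - 2 * a)) ^ 2 / 4
        * (exp ((b - 1) / 2 * ln t - t / 2) / t * (s * Phi a b t * sin (th t)))))); [lra| |].
    - intros t ht; unfold N, th.
      pose proof (is_derive_lnorm a b t hb ltac:(lra)) as e1.
      pose proof (is_derive_lnorm1 a b t hb ltac:(lra)) as e2.
      auto_derive; [repeat split; try (eexists; eassumption); lra|].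
      change (fun x => lnorm a b x) with (lnorm a b).
      change (fun x => lnorm1 a b x) with (lnorm1 a b).
      rewrite (is_derive_unique _ _ _ e1), (is_derive_unique _ _ _ e2).
      change (om * (ln t + - ln y) + ep) with (th t).
      change (om * (ln t - ln y) + ep) with (th t).
      replace (exp ((b - 1) / 2 * ln t - t / 2) / t * (s * Phi a b t * sin (th t)))
        with (s * sin (th t) * lnorm a b t / t) by (unfold lnorm; field; lra).
      set (u := lnorm a b t); set (u1 := lnorm1 a b t); set (S := sin (th t));
        set (C := cos (th t)).
      replace ((t - (b - 2 * a)) ^ 2 / 4)
        with ((t ^ 2 - 2 * (b - 2 * a) * t + (b - 1) ^ 2) / 4 + om * om)
        by (rewrite hom2; unfold discr; field).
      field; lra.
    - intros t ht.
      assert (hnn : 0 <= s * Phi a b t).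
      { destruct (Req_dec t y) as [->|h1]; [rewrite hy0; lra|].
        destruct (Req_dec t z) as [->|h2]; [rewrite hz0; lra|].
        left; apply hpos; lra. }
      specialize (hth t ht).
      assert (0 <= (t - (b - 2 * a)) ^ 2 / 4) by (pose proof (pow2_ge_0 (t - (b - 2 * a))); lra).
      assert (0 <= exp ((b - 1) / 2 * ln t - t / 2) / t)
        by (apply Rdiv_le_0_compat; [left; apply exp_pos | lra]).
      assert (0 <= (t - (b - 2 * a)) ^ 2 / 4
        * (exp ((b - 1) / 2 * ln t - t / 2) / t * (s * Phi a b t * sin (th t)))).
      { apply Rmult_le_pos; [easy|]; apply Rmult_le_pos; [easy|]; apply Rmult_le_pos; lra. }
      lra. }
  assert (hsd : forall x, is_derive (fun t => s * Phi a b t) x (s * dPhi a b x)).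
  { intros x; apply (is_derive_scal (Phi a b)); now apply is_derive_Phi. }
  assert (hs0 : s <> 0) by (intros e; rewrite e in hs; lra).
  assert (hdy : 0 < s * dPhi a b y).
  { assert (0 <= s * dPhi a b y).
    { apply (derivative_nonneg_right (fun t => s * Phi a b t) y z); try easy.
      - intros t ht; left; now apply hpos.
      - rewrite hy0; ring. }
    assert (s * dPhi a b y <> 0); [|lra].
    apply Rmult_integral_contrapositive; split; [easy|].
    apply Phi_simple_zero; lra. }
  assert (hdz : s * dPhi a b z <= 0).
  { apply (derivative_nonpos_left (fun t => s * Phi a b t) y z); try easy.
    - intros t ht; left; now apply hpos.
    - rewrite hz0; ring. }
  assert (hNy : N y < 0).
  { unfold N, lnorm, lnorm1; rewrite hy0.
    specialize (hth y ltac:(lra)).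
    set (X := exp ((b - 1) / 2 * ln y - y / 2)).
    assert (0 < X) by apply exp_pos.
    assert (0 < sin (th y) * (X * (y * (s * dPhi a b y))))
      by (repeat (apply Rmult_lt_0_compat; [lra|]); lra).
    lra. }
  assert (hNz : 0 <= N z).
  { unfold N, lnorm, lnorm1; rewrite hz0.
    specialize (hth z ltac:(lra)).
    set (X := exp ((b - 1) / 2 * ln z - z / 2)).
    assert (0 < X) by apply exp_pos.
    assert (0 <= sin (th z) * (X * (z * (- (s * dPhi a b z)))))
      by (repeat (apply Rmult_le_pos; [lra|]); lra).
    lra. }
  lra.
Qed.

(* To the left of the turning point the normal form is convex in [ln z], hence increasing. *)
Lemma Phi_zero_after_turning_point (a b z : R) : 1 < b -> 0 < z <= b - 2 * a ->
  Phi a b z = 0 -> z ^ 2 - 2 * (b - 2 * a) * z + (b - 1) ^ 2 <= 0.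
Proof.
  intros hb hz h0.
  destruct (Rle_lt_dec (z ^ 2 - 2 * (b - 2 * a) * z + (b - 1) ^ 2) 0) as [h|h]; [easy|exfalso].
  destruct (Phi_first_zero a b z ltac:(lra) ltac:(lra) h0) as [x [hx [hx0 [hdx hpos]]]].
  (* At 0 this bracket of [lnorm1] equals (b - 1) / 2 > 0, so the normal form starts out
     increasing. *)
  destruct (continuity_pt_pos_nbhd (fun t => t * dPhi a b t + (b - 1 - t) / 2 * Phi a b t) 0)
    as [d [hd hnear]].
  { apply continuity_pt_filterlim.
    apply (ex_derive_continuous (fun t => t * dPhi a b t + (b - 1 - t) / 2 * Phi a b t)).
    pose proof (is_derive_Phi a b 0 ltac:(lra)); pose proof (is_derive_dPhi a b 0 ltac:(lra)).
    auto_derive; repeat split; eexists; eassumption. }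
  { rewrite Phi_at_0; lra. }
  set (t0 := Rmin (d / 2) (x / 2)).
  assert (0 < t0) by (apply Rmin_glb_lt; lra).
  assert (t0 <= d / 2) by apply Rmin_l; assert (t0 <= x / 2) by apply Rmin_r.
  assert (h1 : 0 < lnorm1 a b t0).
  { apply Rmult_lt_0_compat; [apply exp_pos|].
    apply hnear; rewrite Rminus_0_r, Rabs_pos_eq; lra. }
  assert (h2 : lnorm1 a b t0 < lnorm1 a b x).
  { apply (mvt_strict (lnorm1 a b)
      (fun t => (t ^ 2 - 2 * (b - 2 * a) * t + (b - 1) ^ 2) / 4 * lnorm a b t / t)); [lra| |].
    - intros t ht; apply is_derive_lnorm1; lra.
    - intros t ht; apply Rdiv_lt_0_compat; [|lra].
      (* The quadratic decreases on (0, b - 2a], so its positivity at z carries over to every t <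
         z. *)
      apply Rmult_lt_0_compat; [nra|].
      apply Rmult_lt_0_compat; [apply exp_pos | apply hpos; lra]. }
  assert (h3 : lnorm1 a b x <= 0).
  { unfold lnorm1; rewrite hx0.
    set (X := exp ((b - 1) / 2 * ln x - x / 2)).
    assert (0 < X) by apply exp_pos.
    assert (0 <= X * (x * - dPhi a b x))
      by (apply Rmult_le_pos; [lra | apply Rmult_le_pos; lra]).
    lra. }
  lra.
Qed.

(** * Motion of the zeros with the parameter *)

Lemma Rabs_sign_mul (s x : R) : s * s = 1 -> Rabs (s * x) = Rabs x.
Proof.
  intros hs; rewrite Rabs_mult.
  assert (Rabs s * Rabs s = 1) by (rewrite <- Rabs_mult, hs; apply Rabs_R1).
  pose proof (Rabs_pos s); replace (Rabs s) with 1 by nra; ring.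
Qed.

(** A substitute for the sign of the a-derivative at a zero: it is opposite to that of the
    z-derivative, so zeros move to the right as a grows. It is [local_sturm] with l = 1, eps = a -
    a' and kap = 1. *)
Lemma Phi_sign_at_crossing (a b z : R) : 0 < b -> 0 < z -> Phi a b z = 0 ->
  exists r, 0 < r /\ forall a', 0 < Rabs (a' - a) < r ->
    0 < (a - a') * (Phi a' b z * dPhi a b z).
Proof.
  intros hb hz h0.
  destruct (local_sturm a b z 1 1 hb hz Rlt_0_1 h0) as [r [hr h]].
  exists r; split; [easy|]; intros a' ha'.
  rewrite <- (Rmult_1_l z) at 1.
  apply (h a' 1 (a - a') (fun _ => 1)); try easy; try lra.
  - intros e; replace (a' - a) with (- (a - a')) in ha' by ring.
    rewrite e, Ropp_0, Rabs_R0 in ha'; lra.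
  - intros t _; unfold qdiff; field.
  - intros t _; lra.
Qed.

(** Away from z a positive minimum survives a small change of a. Near z that minimum degenerates;
    there s Phi a' b is decreasing and, by the crossing lemma, already positive at z. *)
Lemma Phi_pos_after_crossing (s a b y0 z : R) : 0 < b -> s * s = 1 -> 0 < y0 < z ->
  Phi a b z = 0 -> (forall t, y0 <= t < z -> 0 < s * Phi a b t) ->
  exists r, 0 < r /\ forall a' x, a < a' < a + r -> y0 <= x <= z -> 0 < s * Phi a' b x.
Proof.
  intros hb hs hy h0 hpos.
  pose proof (fun x => Rabs_sign_mul s x hs) as hsabs.
  assert (hneg : s * dPhi a b z < 0).
  { assert (s * dPhi a b z <= 0).
    { apply (derivative_nonpos_left (fun t => s * Phi a b t) y0 z); try lra.
      - apply (is_derive_scal (Phi a b)); now apply is_derive_Phi.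
      - intros t ht; left; apply hpos; lra.
      - rewrite h0; ring. }
    assert (s * dPhi a b z <> 0); [|lra].
    apply Rmult_integral_contrapositive; split; [intros e; rewrite e in hs; lra|].
    apply Phi_simple_zero; lra. }
  destruct (Phi_lipschitz (Rabs a + 1) b z hb) as [L [hL hLip]].
  destruct (dPhi_lipschitz (Rabs a + 1) b z hb) as [L' [hL' hLip']].
  destruct (Phi_sign_at_crossing a b z hb ltac:(lra) h0) as [r2 [hr2 hcross]].
  (* Within r1 in both a and z, the derivative changes by at most half of its value at (a, z), so it
     keeps its sign. *)
  set (r1 := - (s * dPhi a b z) / (4 * L')).
  assert (hr1 : 0 < r1) by (apply Rdiv_lt_0_compat; lra).
  set (r1' := Rmin r1 ((z - y0) / 2)).
  assert (hr1' : 0 < r1') by (apply Rmin_glb_lt; lra).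
  assert (hr1a : r1' <= r1) by apply Rmin_l.
  assert (hr1b : r1' <= (z - y0) / 2) by apply Rmin_r.
  destruct (continuity_ab_min (fun t => s * Phi a b t) y0 (z - r1')) as [x0 [hmin hx0]].
  { lra. }
  { intros t _; apply continuity_pt_scal; now apply continuous_Phi. }
  set (mu := s * Phi a b x0) in *.
  assert (hmu : 0 < mu) by (apply hpos; lra).
  set (r := Rmin (Rmin 1 r1) (Rmin r2 (mu / (2 * L)))).
  assert (hmuL : 0 < mu / (2 * L)) by (apply Rdiv_lt_0_compat; lra).
  exists r; split; [repeat apply Rmin_glb_lt; lra|].
  intros a' x ha' hx.
  assert (a' - a < 1)
    by (apply Rlt_le_trans with r; [lra | apply Rle_trans with (1 := Rmin_l _ _), Rmin_l]).
  assert (a' - a < r1)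
    by (apply Rlt_le_trans with r; [lra | apply Rle_trans with (1 := Rmin_l _ _), Rmin_r]).
  assert (a' - a < r2)
    by (apply Rlt_le_trans with r; [lra | apply Rle_trans with (1 := Rmin_r _ _), Rmin_l]).
  assert (hamu : a' - a < mu / (2 * L))
    by (apply Rlt_le_trans with r; [lra | apply Rle_trans with (1 := Rmin_r _ _), Rmin_r]).
  assert (hAa' : Rabs a' <= Rabs a + 1).
  { pose proof (Rabs_triang (a' - a) a) as ht.
    replace (a' - a + a) with a' in ht by ring; rewrite (Rabs_pos_eq (a' - a)) in ht; lra. }
  destruct (Rle_lt_dec x (z - r1')) as [hc|hc].
  - specialize (hmin x ltac:(lra)).
    specialize (hLip a' a x x hAa' ltac:(lra) ltac:(lra) ltac:(lra)).
    rewrite Rminus_diag, Rabs_R0, (Rabs_pos_eq (a' - a)), Rplus_0_r in hLip by lra.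
    rewrite <- hsabs in hLip; apply Rabs_le_between in hLip.
    assert (L * (a' - a) < L * (mu / (2 * L))) by (apply Rmult_lt_compat_l; lra).
    replace (L * (mu / (2 * L))) with (mu / 2) in * by (field; lra); lra.
  - assert (hend : 0 < s * Phi a' b z).
    { specialize (hcross a' ltac:(rewrite Rabs_pos_eq; lra)).
      replace ((a - a') * (Phi a' b z * dPhi a b z))
        with ((a' - a) * ((s * Phi a' b z) * - (s * dPhi a b z))) in hcross.
      - destruct (Rlt_le_dec 0 (s * Phi a' b z)) as [h|h]; [easy|exfalso].
        assert (0 <= (a' - a) * ((- (s * Phi a' b z)) * - (s * dPhi a b z)))
          by (apply Rmult_le_pos; [lra | apply Rmult_le_pos; lra]).
        lra.
      - transitivity ((s * s) * ((a - a') * (Phi a' b z * dPhi a b z))); [ring|].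
        rewrite hs; ring. }
    assert (hdec : s * Phi a' b z - s * Phi a' b x <= 0 * (z - x)); [|lra].
    apply (mvt_upper (fun t => s * Phi a' b t) (fun t => s * dPhi a' b t)); [lra| |].
    + intros t _; apply (is_derive_scal (Phi a' b)); now apply is_derive_Phi.
    + intros t ht.
      specialize (hLip' a' a t z hAa' ltac:(lra) ltac:(lra) ltac:(lra)).
      rewrite (Rabs_minus_sym t), (Rabs_pos_eq (a' - a)), (Rabs_pos_eq (z - t)) in hLip' by lra.
      rewrite <- hsabs in hLip'; apply Rabs_le_between in hLip'.
      assert (L' * (a' - a + (z - t)) <= L' * (2 * r1)) by (apply Rmult_le_compat_l; lra).
      replace (L' * (2 * r1)) with (- (s * dPhi a b z) / 2) in * by (unfold r1; field; lra).
      lra.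
Qed.

Lemma point_just_below (p m d : R) : p < m -> 0 < d -> exists u, p < u < m /\ m - u < d.
Proof.
  intros hp hd; exists (Rmax ((p + m) / 2) (m - d / 2)); split; [split|].
  - apply Rlt_le_trans with (2 := Rmax_l _ _); lra.
  - apply Rmax_lub_lt; lra.
  - pose proof (Rmax_r ((p + m) / 2) (m - d / 2)); lra.
Qed.

(* As [a] increases, a zero [z] of [Phi a b] moves so that [z (b - 2 a) - z^2 / 2] does not
   increase: the level curve [al] of that quantity through [(ak1, zl)] is never crossed upwards.
   Otherwise [Phi (al t) b] would keep its sign on [[t, zl]] until [t = zl], and the first [m]
   where it fails contradicts simplicity of zeros, the gap (ak, ak1), or [local_sturm]. *)
Lemma zero_level_nonincreasing (b zl ak ak1 y : R) : 0 < b -> 0 < y < zl -> ak < ak1 ->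
  zl <= b - 2 * ak1 ->
  Phi ak b zl = 0 -> Phi ak1 b zl = 0 -> Phi ak b y = 0 ->
  (forall t, y < t < zl -> Phi ak b t <> 0) ->
  (forall a, ak < a < ak1 -> Phi a b zl <> 0) ->
  zl * (b - 2 * ak1) - zl ^ 2 / 2 <= y * (b - 2 * ak) - y ^ 2 / 2.
Proof.
  intros hb hy haa hB hak hak1 hy0 hn hconsec.
  set (c := zl * (b - 2 * ak1) - zl ^ 2 / 2).
  destruct (Rle_lt_dec c (y * (b - 2 * ak) - y ^ 2 / 2)) as [h|hlt]; [easy|exfalso].
  destruct (constant_sign (Phi ak b) y zl) as [s [hs hpos]]; try easy; try lra.
  { intros t; now apply continuous_Phi. }
  pose proof (fun x => Rabs_sign_mul s x hs) as hsabs.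
  assert (hs0 : s <> 0) by (intros e; rewrite e in hs; lra).
  (* This makes the level curve increasing: the derivative of [al] is (c / t^2 - 1/2) / 2, positive
     for t < zl. *)
  assert (hc2 : zl * zl / 2 <= c) by (unfold c; nra).
  (* z0 is where the level curve meets the parameter ak. It lies strictly between y and zl, since
     the level of (ak, y) is below c and that of (ak, zl) above, so s Phi ak b is positive on [z0,
     zl). *)
  destruct (IVT (fun t => t * (b - 2 * ak) - t ^ 2 / 2 - c) y zl) as [z0 [hz0 ez0]].
  { intros t; apply continuity_pt_filterlim.
    apply (ex_derive_continuous (fun t => t * (b - 2 * ak) - t ^ 2 / 2 - c)).
    auto_derive; easy. }
  { lra. }
  { lra. }
  { unfold c; nra. }
  cbv beta in ez0.
  assert (hz0y : y < z0).
  { destruct (proj1 hz0) as [h|h]; [easy|]; rewrite <- h in ez0; lra. }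
  assert (hz0l : z0 < zl).
  { destruct (proj2 hz0) as [h|h]; [easy|]; rewrite h in ez0; unfold c in ez0; nra. }
  set (al := fun t => (b - c / t - t / 2) / 2).
  assert (hal0 : al z0 = ak).
  { unfold al; replace c with (z0 * (b - 2 * ak) - z0 ^ 2 / 2) by lra; field; lra. }
  assert (hal1 : al zl = ak1) by (unfold al, c; field; lra).
  set (Ka := c / (z0 * z0)).
  assert (hz00 : 0 < z0 * z0) by nra.
  assert (hc0 : 0 < c) by nra.
  assert (hKa : 0 < Ka) by now apply Rdiv_lt_0_compat.
  assert (haldiff : forall t u, z0 <= t -> t < u -> u <= zl -> 0 < al u - al t <= Ka * (u - t)).
  { intros t u ht htu hu.
    assert (htu0 : 0 < t * u) by (apply Rmult_lt_0_compat; lra).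
    assert (t * u < zl * zl).
    { apply Rlt_le_trans with (zl * u);
        [apply Rmult_lt_compat_r | apply Rmult_le_compat_l]; lra. }
    replace (al u - al t) with ((c / (t * u) - 1 / 2) * ((u - t) / 2)) by (unfold al; field; lra).
    assert (h1 : 1 / 2 < c / (t * u)) by (apply -> Rlt_div_r; lra).
    assert (h2 : c / (t * u) <= Ka).
    { unfold Ka; apply Rmult_le_compat_l; [lra|].
      apply Rinv_le_contravar; [easy|].
      apply Rmult_le_compat; lra. }
    split; [apply Rmult_lt_0_compat; lra|].
    apply Rmult_le_compat; lra. }
  assert (halrange : forall t, z0 < t < zl -> ak < al t < ak1).
  { intros t ht; rewrite <- hal0, <- hal1.
    pose proof (haldiff z0 t ltac:(lra) ltac:(lra) ltac:(lra)).
    pose proof (haldiff t zl ltac:(lra) ltac:(lra) ltac:(lra)); lra. }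
  set (A := Rabs ak + Rabs ak1).
  assert (hA : forall t, z0 <= t <= zl -> Rabs (al t) <= A).
  { intros t ht.
    assert (ak <= al t <= ak1).
    { destruct (Req_dec t z0) as [->|h1]; [lra|].
      destruct (Req_dec t zl) as [->|h2]; [lra|].
      specialize (halrange t ltac:(lra)); lra. }
    pose proof (Rle_abs ak1); pose proof (Rle_abs (- ak)) as h; rewrite Rabs_Ropp in h.
    pose proof (Rabs_pos ak); pose proof (Rabs_pos ak1).
    apply Rabs_le_between; unfold A; lra. }
  destruct (Phi_lipschitz A b zl hb) as [L [hL hLip]].
  set (G := fun t x => s * Phi (al t) b x).
  assert (hG : forall t u x x', z0 <= t <= zl -> z0 <= u <= zl -> 0 <= x <= zl -> 0 <= x' <= zl ->
    Rabs (G t x - G u x') <= L * (Ka * Rabs (t - u) + Rabs (x - x'))).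
  { intros t u x x' ht hu hx hx'.
    replace (G t x - G u x') with (s * (Phi (al t) b x - Phi (al u) b x')) by (unfold G; ring).
    rewrite hsabs.
    apply Rle_trans with (1 := hLip _ _ _ _ (hA t ht) (hA u hu) hx hx').
    apply Rmult_le_compat_l; [lra|]; apply Rplus_le_compat_r.
    destruct (Rtotal_order t u) as [h|[->|h]].
    - specialize (haldiff t u ltac:(lra) h ltac:(lra)).
      rewrite Rabs_minus_sym, (Rabs_minus_sym t), !Rabs_pos_eq; lra.
    - rewrite !Rminus_diag, Rabs_R0; lra.
    - specialize (haldiff u t ltac:(lra) h ltac:(lra)).
      rewrite !Rabs_pos_eq; lra. }
  set (good := fun t => forall x, t <= x <= zl -> 0 < G t x).
  assert (hstart : exists d, 0 < d /\ forall t, z0 < t < z0 + d -> t <= zl -> good t).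
  { destruct (Phi_pos_after_crossing s ak b z0 zl) as [r [hr hr']]; try easy; try lra.
    { intros t ht; apply hpos; lra. }
    exists (r / Ka); split; [now apply Rdiv_lt_0_compat|].
    intros t ht htl x hx; apply hr'; [|lra].
    pose proof (haldiff z0 t ltac:(lra) ltac:(lra) ltac:(lra)) as hd; rewrite hal0 in hd.
    assert (Ka * (t - z0) < r); [|lra].
    replace r with (Ka * (r / Ka)) by (field; lra).
    apply Rmult_lt_compat_l; lra. }
  destruct hstart as [d0 [hd0 hstart]].
  assert (hgoodopen : forall m, z0 < m < zl -> good m ->
    exists e, 0 < e /\ forall u, z0 < u <= zl -> Rabs (u - m) < e -> good u).
  { intros m hm hgm.
    destruct (continuity_ab_min (G m) m zl) as [x0 [hmin hx0]].
    { lra. }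
    { intros t _; apply continuity_pt_scal; now apply continuous_Phi. }
    pose proof (hgm x0 hx0) as hmu.
    set (e := G m x0 / (L * (Ka + 1))).
    assert (hLK : 0 < L * (Ka + 1)) by (apply Rmult_lt_0_compat; lra).
    exists e; split; [now apply Rdiv_lt_0_compat|].
    intros u hu hum x hx.
    (* The interval [u, zl] varies with u; clamping x to [m, zl] moves it by at most |u - m|. *)
    assert (hx' : m <= Rmax x m <= zl) by (split; [apply Rmax_r | apply Rmax_lub; lra]).
    specialize (hmin _ hx').
    pose proof (hG u m x (Rmax x m) ltac:(lra) ltac:(lra) ltac:(lra) ltac:(lra)) as hGu.
    assert (hxm : Rabs (x - Rmax x m) <= Rabs (u - m)).
    { unfold Rmax; destruct (Rle_dec x m).
      - rewrite (Rabs_minus_sym x), (Rabs_minus_sym u), !Rabs_pos_eq; lra.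
      - rewrite Rminus_diag, Rabs_R0; apply Rabs_pos. }
    assert (L * (Ka * Rabs (u - m) + Rabs (x - Rmax x m)) < G m x0).
    { replace (G m x0) with (L * (Ka * e + e)) by (unfold e; field; lra).
      apply Rmult_lt_compat_l; [easy|].
      apply Rplus_lt_le_compat; [apply Rmult_lt_compat_l; lra | lra]. }
    apply Rabs_le_between in hGu; lra. }
  (* Only u > z0 is considered: [good z0] fails at x = zl, where Phi ak b vanishes. *)
  destruct (completeness (fun t => z0 <= t <= zl /\ forall u, z0 < u <= t -> good u))
    as [m [hub hlub]].
  { exists zl; intros t [ht _]; lra. }
  { exists z0; split; [lra|]; intros u hu; lra. }
  assert (hm0 : z0 < m).
  { set (t := Rmin (z0 + d0 / 2) zl).
    assert (ht1 : t <= z0 + d0 / 2) by apply Rmin_l; assert (ht2 : t <= zl) by apply Rmin_r.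
    assert (ht3 : z0 < t) by (apply Rmin_glb_lt; lra).
    apply Rlt_le_trans with t; [easy|].
    apply hub; split; [lra|]; intros u hu; apply hstart; lra. }
  assert (hml : m <= zl) by (apply hlub; intros t [ht _]; lra).
  assert (hbelow : forall u, z0 < u < m -> good u).
  { intros u hu; destruct (classic (good u)) as [h|h]; [easy|exfalso].
    assert (m <= u); [|lra].
    apply hlub; intros t [ht hgt].
    destruct (Rle_lt_dec t u) as [htu|htu]; [easy|].
    exfalso; apply h, hgt; lra. }
  assert (hbad : exists x, m <= x <= zl /\ G m x <= 0).
  { destruct (classic (exists x, m <= x <= zl /\ G m x <= 0)) as [h|h]; [easy|exfalso].
    assert (hgm : good m).
    { intros x hx; destruct (Rlt_le_dec 0 (G m x)) as [h1|h1]; [easy|].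
      exfalso; apply h; now exists x. }
    destruct hml as [hml|hml].
    - destruct (hgoodopen m ltac:(lra) hgm) as [e [he hopen]].
      set (t := Rmin (m + e / 2) zl).
      assert (ht1 : t <= m + e / 2) by apply Rmin_l; assert (ht2 : t <= zl) by apply Rmin_r.
      assert (ht3 : m < t) by (apply Rmin_glb_lt; lra).
      assert (t <= m); [|lra].
      apply hub; split; [lra|]; intros u hu.
      destruct (Rlt_le_dec u m) as [hum|hum]; [apply hbelow; lra|].
      apply hopen; [lra | rewrite Rabs_pos_eq; lra].
    - specialize (hgm m ltac:(lra)); unfold G in hgm.
      rewrite hml, hal1, hak1 in hgm; lra. }
  assert (hnn : forall x, m <= x <= zl -> 0 <= G m x).
  { intros x hx; destruct (Rle_lt_dec 0 (G m x)) as [h|h]; [easy|exfalso].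
    assert (hLK : 0 < L * Ka) by now apply Rmult_lt_0_compat.
    destruct (point_just_below z0 m (- G m x / (L * Ka))) as [u [hu hum]]; try easy.
    { apply Rdiv_lt_0_compat; lra. }
    pose proof (hbelow u hu x ltac:(lra)) as hgu.
    pose proof (hG u m x x ltac:(lra) ltac:(lra) ltac:(lra) ltac:(lra)) as hGu.
    rewrite Rminus_diag, Rabs_R0, (Rabs_minus_sym u), (Rabs_pos_eq (m - u)), Rplus_0_r in hGu by lra.
    apply Rabs_le_between in hGu.
    assert (L * Ka * (m - u) < L * Ka * (- G m x / (L * Ka))) by (apply Rmult_lt_compat_l; lra).
    replace (L * Ka * (- G m x / (L * Ka))) with (- G m x) in * by (field; lra); lra. }
  assert (hGd : forall x, is_derive (G m) x (s * dPhi (al m) b x)).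
  { intros x; apply (is_derive_scal (Phi (al m) b)); now apply is_derive_Phi. }
  assert (hGz : forall x, G m x = 0 -> Phi (al m) b x = 0).
  { intros x hx; apply Rmult_integral in hx; tauto. }
  destruct hbad as [x [hx hGx]].
  assert (hGx0 : G m x = 0) by (specialize (hnn x hx); lra).
  (* A zero x > m is impossible: at zl it contradicts the gap between ak and ak1, and before zl it
     would be a double zero. *)
  destruct (Req_dec x m) as [e|hxm].
  2: { destruct (Req_dec x zl) as [->|hxl].
    - apply (hconsec (al m)); [apply halrange; lra | now apply hGz].
    - assert (s * dPhi (al m) b x <= 0).
      { apply (derivative_nonpos_left (G m) m x); try easy; [lra|].
        intros t ht; apply hnn; lra. }
      assert (0 <= s * dPhi (al m) b x).
      { apply (derivative_nonneg_right (G m) x zl); try easy; [lra|].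
        intros t ht; apply hnn; lra. }
      apply (Phi_simple_zero (al m) b x); [easy | lra | now apply hGz |].
      assert (hz : s * dPhi (al m) b x = 0) by lra.
      apply Rmult_integral in hz; tauto. }
  subst x.
  (* The remaining zero is m itself. If m = zl, nothing lies to its right within the range, and the
     sign comes from comparing Phi (al u) b zl with ak1 for u slightly below zl. *)
  assert (hd : 0 <= s * dPhi (al m) b m).
  { destruct hml as [hml|hml].
    - apply (derivative_nonneg_right (G m) m zl); try easy.
      intros t ht; apply hnn; lra.
    - rewrite hml, hal1.
      destruct (Phi_sign_at_crossing ak1 b zl hb ltac:(lra) hak1) as [r [hr hcross]].
      destruct (point_just_below z0 zl (r / Ka)) as [u [hu hul]]; try easy.
      { now apply Rdiv_lt_0_compat. }
      pose proof (haldiff u zl ltac:(lra) ltac:(lra) ltac:(lra)) as hau; rewrite hal1 in hau.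
      assert (Ka * (zl - u) < r).
      { replace r with (Ka * (r / Ka)) by (field; lra); apply Rmult_lt_compat_l; lra. }
      specialize (hcross (al u) ltac:(rewrite Rabs_minus_sym, Rabs_pos_eq; lra)).
      pose proof (hbelow u ltac:(lra) zl ltac:(lra)) as hgu; unfold G in hgu.
      replace ((ak1 - al u) * (Phi (al u) b zl * dPhi ak1 b zl))
        with ((ak1 - al u) * ((s * Phi (al u) b zl) * (s * dPhi ak1 b zl))) in hcross.
      + destruct (Rle_lt_dec 0 (s * dPhi ak1 b zl)) as [h|h]; [easy|exfalso].
        assert (0 <= (ak1 - al u) * ((s * Phi (al u) b zl) * - (s * dPhi ak1 b zl)))
          by (apply Rmult_le_pos; [lra | apply Rmult_le_pos; lra]).
        lra.
      + transitivity ((s * s) * ((ak1 - al u) * (Phi (al u) b zl * dPhi ak1 b zl))); [ring|].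
        rewrite hs; ring. }
  destruct (local_sturm (al m) b m m (m / 2) hb ltac:(lra) ltac:(lra) (hGz m hGx0))
    as [r [hr hloc]].
  (* The first bound gives al m - al u < r, the second 1 - u / m < r. *)
  destruct (point_just_below z0 m (Rmin (r / Ka) (r * m))) as [u [hu hum]]; try easy.
  { apply Rmin_glb_lt; [now apply Rdiv_lt_0_compat | apply Rmult_lt_0_compat; lra]. }
  pose proof (Rmin_l (r / Ka) (r * m)); pose proof (Rmin_r (r / Ka) (r * m)).
  pose proof (haldiff u m ltac:(lra) ltac:(lra) ltac:(lra)) as hau.
  assert (Ka * (m - u) < r).
  { replace r with (Ka * (r / Ka)) by (field; lra); apply Rmult_lt_compat_l; lra. }
  assert (hlm : u / m < 1) by (apply Rlt_div_l; lra).
  assert (hlm0 : 0 < u / m) by (apply Rdiv_lt_0_compat; lra).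
  assert (heps : 0 < (1 - (u / m) ^ 2) / 4) by nra.
  (* Both points lie on the level c, so with l = u / m the function [qdiff] is -(1 - l^2) / 4 times
     m - z. Hence Phi (al u) b u and dPhi (al m) b m have opposite signs, although neither is
     negative after multiplication by s. *)
  assert (hfin : 0 < - ((1 - (u / m) ^ 2) / 4) * (Phi (al u) b (u / m * m) * dPhi (al m) b m)).
  { apply (hloc (al u) (u / m) _ (fun z => m - z)).
    - rewrite Rabs_minus_sym, Rabs_pos_eq; lra.
    - split; [|lra]; apply Rlt_div_r; lra.
    - lra.
    - intros z hz; unfold qdiff, al; field; lra.
    - intros z hz; lra.
    - intros z hz; lra. }
  replace (u / m * m) with u in hfin by (field; lra).
  pose proof (hbelow u hu u ltac:(lra)) as hgu; unfold G in hgu.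
  assert (0 <= (1 - (u / m) ^ 2) / 4 * ((s * Phi (al u) b u) * (s * dPhi (al m) b m)))
    by (apply Rmult_le_pos; [lra | apply Rmult_le_pos; lra]).
  replace ((s * Phi (al u) b u) * (s * dPhi (al m) b m))
    with ((s * s) * (Phi (al u) b u * dPhi (al m) b m)) in * by ring.
  rewrite hs in *; lra.
Qed.

(** * The spacing bound *)

Lemma g_gt_1 (b a : R) : 0 < discr b a -> 1 < g b a.
Proof.
  intros h; unfold g; rewrite <- exp_0; apply exp_increasing.
  pose proof PI_RGT_0; apply Rdiv_lt_0_compat; [lra | now apply sqrt_lt_R0].
Qed.

(** Squared, the claim reads z^2 - 2 (b - 2a) z + (b - 2)^2 <= 0. For b > 2 it follows from the
    turning-point inequality, as (b - 2)^2 <= (b - 1)^2; for b <= 2 it follows from b - 2 + z <= z <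
    beta. *)
Lemma zero_times_beta_lower (a b z : R) : 0 < b -> 0 < z < beta b a -> a < 1 ->
  Phi a b z = 0 -> b - 2 + z <= 2 * sqrt (z * beta b a).
Proof.
  intros hb hz ha h0; unfold beta in *.
  destruct (Rle_lt_dec (b - 2 + z) 0) as [h|h].
  { pose proof (sqrt_pos (z * (b - a - 1))); lra. }
  assert (hsq : (b - 2 + z) ^ 2 <= 4 * (z * (b - a - 1))).
  { destruct (Rle_lt_dec b 2) as [hb2|hb2]; [nra|].
    pose proof (Phi_zero_after_turning_point a b z ltac:(lra) ltac:(lra) h0); nra. }
  assert (h1 : (b - 2 + z) / 2 <= sqrt (z * (b - a - 1))); [|lra].
  rewrite <- (sqrt_pow2 ((b - 2 + z) / 2)) by lra.
  apply sqrt_le_1_alt; nra.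
Qed.

(* [ak1] is the zero a_{k-1}^*, [ak] the next one below it, a_k^*. *)
Theorem theorem1 (b zl ak ak1 : R)
  (hb : 0 < b) (hz : 0 < zl)
  (hlt : ak < ak1)
  (hak : Phi ak b zl = 0)
  (hak1 : Phi ak1 b zl = 0)
  (hconsec : forall a : R, ak < a < ak1 -> Phi a b zl <> 0)
  (hdiscr : 0 < discr b ak1)
  (hzl : zl < beta b ak1 / g b ak1) :
  ak1 - ak >=
    beta b ak
    - beta b ak / (4 * g b ak)
      * (2 + sqrt (zl / beta b ak) * (g b ak - 1)) ^ 2.
Proof.
  assert (hz1 : zl < beta b ak1).
  { pose proof (g_gt_1 b ak1 hdiscr).
    apply Rlt_div_r in hzl; [nra | lra]. }
  assert (hfact : forall a, discr b a = (1 - 2 * a) * (2 * b - 2 * a - 1))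
    by (intros a; unfold discr; ring).
  (* From 0 < zl < b - ak1 - 1 the second factor of [discr] is positive, so the first one is too.
     Both factors grow as a decreases, which makes [g b ak] meaningful. *)
  assert (hhalf : ak1 < 1 / 2).
  { rewrite hfact in hdiscr; unfold beta in hz1; nra. }
  assert (hdk : 0 < discr b ak).
  { rewrite hfact; unfold beta in hz1; apply Rmult_lt_0_compat; lra. }
  pose proof (g_gt_1 b ak hdk) as hg.
  assert (hbk : zl < beta b ak) by (unfold beta in *; lra).
  assert (hkey := zero_times_beta_lower ak b zl hb ltac:(lra) ltac:(lra) hak).
  destruct (Phi_zero_below ak ak1 b zl hb hlt hz hak1) as [x [hx hx0]].
  destruct (Phi_previous_zero ak b x zl hb hx hx0 hak) as [y [hy [hy0 hn]]].
  pose proof (Phi_zero_spacing ak b y zl hb hy hdk hy0 hak hn) as hspace.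
  assert (hlev : zl * (b - 2 * ak1) - zl ^ 2 / 2 <= y * (b - 2 * ak) - y ^ 2 / 2).
  { apply zero_level_nonincreasing; try easy; unfold beta in hz1; lra. }
  set (e := / g b ak).
  assert (heg : e * g b ak = 1) by (unfold e; field; lra).
  assert (he : 0 < e < 1).
  { split; [apply Rinv_0_lt_compat; lra|].
    rewrite <- Rinv_1; apply Rinv_lt_contravar; lra. }
  assert (hye : y <= e * zl) by nra.
  (* The level t (b - 2 ak) - t^2 / 2 increases for t <= b - 2 ak, so y may be replaced by its upper
     bound e zl; then zl is divided out. *)
  assert (hel : b - 2 * ak1 - zl / 2 <= e * (b - 2 * ak) - e ^ 2 * zl / 2).
  { apply Rmult_le_reg_l with zl; [easy|].
    apply Rle_trans with (y * (b - 2 * ak) - y ^ 2 / 2); [lra|].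
    assert (0 <= (e * zl - y) * (b - 2 * ak - (e * zl + y) / 2)); [|nra].
    apply Rmult_le_pos; [lra|].
    assert (e * zl <= zl) by nra; unfold beta in hz1; lra. }
  assert (hsq : beta b ak * sqrt (zl / beta b ak) = sqrt (zl * beta b ak)).
  { rewrite <- (sqrt_pow2 (beta b ak)) at 1 by lra.
    rewrite <- sqrt_mult by (try apply pow2_ge_0; apply Rdiv_le_0_compat; lra).
    f_equal; field; lra. }
  assert (hsq2 : beta b ak * sqrt (zl / beta b ak) ^ 2 = zl).
  { rewrite pow2_sqrt by (apply Rdiv_le_0_compat; lra); field; lra. }
  replace (beta b ak / (4 * g b ak) * (2 + sqrt (zl / beta b ak) * (g b ak - 1)) ^ 2)
    with (e * (beta b ak + (beta b ak * sqrt (zl / beta b ak)) * (g b ak - 1)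
       + (beta b ak * sqrt (zl / beta b ak) ^ 2) * (g b ak - 1) ^ 2 / 4))
    by (unfold e; field; lra).
  rewrite hsq, hsq2.
  set (r := sqrt (zl * beta b ak)) in *; set (G := g b ak) in *.
  (* Since e G = 1, each e (G - 1) becomes 1 - e, and the claimed bound is (1 - e) (beta - r - zl (G
     - 1) / 4). *)
  replace (e * (beta b ak + r * (G - 1) + zl * (G - 1) ^ 2 / 4))
    with (e * beta b ak + (e * G - e) * r + (e * G - e) * (zl * (G - 1) / 4)) by field.
  rewrite heg; apply Rle_ge.
  (* [hel] bounds ak1 - ak below by 1 - e times the right-hand side. As e <= G, the comparison of
     the two factors reduces to b - 2 + zl <= 2 r, which is [hkey]. *)
  assert (hmain : beta b ak - r - zl * (G - 1) / 4 <= (b - 2 * ak) / 2 - zl / 4 * (1 + e)).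
  { assert (zl * (1 + e) <= zl * (G + 1)) by (apply Rmult_le_compat_l; lra).
    unfold beta; nra. }
  apply (Rmult_le_compat_l (1 - e)) in hmain; [|lra].
  nra.
Qed.
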